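(* Let $G$ be a fixed finite simple graph with minimum degree $\delta(G)\ge 5$ which contains two edge-disjoint Hamilton cycles $H_1,H_2$ such that the graph $H_1\cup H_2$ is not bipartite. Then asymptotically almost surely (as $n\to\infty$) a random $n$-lift $\tilde G$ of $G$ is Hamiltonian, i.e. $\Pr[\tilde G \text{ contains a Hamilton cycle}]\to 1$ as $n\to\infty$.
   Context: For a graph $G$ and a positive integer $n$, an $n$-lift of $G$ is a graph $\tilde G$ obtained as follows: each vertex $u$ of $G$ is replaced by a set (fiber) $\tilde G_u=\{u_1,\dots,u_n\}$ of $n$ vertices, the fibers being pairwise disjoint, and for every edge $uv$ of $G$ the fibers $\tilde G_u$ and $\tilde G_v$ are joined by a perfect matching (i.e. for some permutation $\sigma_{uv}$ of $[n]$, $u_i$ is joined to $v_{\sigma_{uv}(i)}$ for all $i$); there are no other edges. A random $n$-lift of $G$ is obtained by choosing, independently for each edge $uv$ of $G$, the permutation $\sigma_{uv}$ uniformly at random among all $n!$ permutations of $[n]$ (equivalently, a uniformly random element of the set $L_n(G)$ of all $n$-lifts). A property holds asymptotically almost surely (aas) if its probability tends to $1$ as $n\to\infty$, with $G$ fixed. *)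

(* Defs.v *)
From mathcomp Require Import all_boot all_order all_algebra perm.
From mathcomp Require Import boolp classical_sets reals topology normedtype sequences.

Set Implicit Arguments.
Unset Strict Implicit.
Unset Printing Implicit Defensive.

Import Order.TTheory GRing.Theory Num.Theory numFieldNormedType.Exports.

Record sgraph := SGraph {
  vertex :> finType;
  adj : rel vertex;
  adj_sym : symmetric adj;
  adj_irrefl : irreflexive adj
}.

Definition degree (G : sgraph) (u : G) : nat := #|[set v | adj u v]|.

(* A Hamilton cycle is the sequence of all the vertices in cyclic order of
   traversal.  The size condition excludes the degenerate closed walks on at
   most two vertices, which [ucycleb] accepts. *)
Definition hamilton_cycle (G : sgraph) (c : seq G) : bool :=
  [&& 2 < size c, ucycleb (@adj G) c & [forall u : G, u \in c]].

Definition hamiltonian (G : sgraph) : Prop :=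
  exists c : seq G, hamilton_cycle c.

Definition cycle_edge (V : eqType) (c : seq V) : rel V :=
  fun u v => (u \in c) && (v == next c u) || (v \in c) && (u == next c v).

Definition edge_disjoint (V : eqType) (c1 c2 : seq V) : Prop :=
  forall u v, ~~ (cycle_edge c1 u v && cycle_edge c2 u v).

Definition bipartite (V : Type) (r : rel V) : Prop :=
  exists side : V -> bool, forall u v, r u v -> side u != side v.

(* Each edge {u, v} is represented exactly once, by the pair (u, v) that is
   increasing in the enumeration of the vertices.  This fixes which of the two
   mutually inverse permutations of an edge is the chosen one. *)
Definition edge (G : sgraph) : predArgType :=
  {p : G * G | adj p.1 p.2 && (enum_rank p.1 < enum_rank p.2)}.

Section Lift.
Variables (G : sgraph) (n : nat) (s : {ffun edge G -> 'S_n}).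

Definition lift_adj : rel (G * 'I_n) := fun x y =>
  [exists a : edge G,
     (val a == (x.1, y.1)) && (s a x.2 == y.2)
     || (val a == (y.1, x.1)) && (s a y.2 == x.2)].

Lemma lift_adj_sym : symmetric lift_adj.
Proof. by move=> x y; apply: eq_existsb => a; rewrite orbC. Qed.

Lemma lift_adj_irrefl : irreflexive lift_adj.
Proof.
move=> x; apply/negbTE/negP => /existsP [[p /= adjp]].
case/orP=> /andP[/eqP defp _]; move: adjp.
all: by rewrite defp /= adj_irrefl.
Qed.

Definition lift_graph : sgraph := SGraph lift_adj_sym lift_adj_irrefl.

End Lift.

Definition unif_prob (R : realType) (Omega : finType) (A : set Omega) : R :=
  (#|[pred w | `[< A w >]]|%:R / #|Omega|%:R)%R.

(* The uniform law on families of permutations indexed by the edges is the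
   product law: the permutations are independent and uniform. *)
Definition lift_prob (R : realType) (G : sgraph) (n : nat)
    (P : sgraph -> Prop) : R :=
  unif_prob R [set s : {ffun edge G -> 'S_n} | P (lift_graph s)]%classic.

Definition lift_aas (R : realType) (G : sgraph) (P : sgraph -> Prop) : Prop :=
  ((fun n => lift_prob R G n P) @ \oo --> (1 : R)%R)%classic.

(* Main.v *)
(* In a random lift, the lift of the first Hamilton cycle is a family of few
   disjoint cycles: at most y = n^(1/20), as the expectation of 2^(number of cycles) is n + 1.
   The target sets [target j] consist of the lifts covered by one path and fewer than [j] of these
   cycles, the path making only few steps outside the lift of the first cycle ([target 0]: such a
   Hamilton cycle), and it suffices to bound, for each [j], the number of lifts that lie in
   [target j.+1] but not in [target j].

   Minimum degree 5 makes small sets of vertices expand by a factor larger than 2, so y Posa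
   rotations at either end of the path yield n^(6/5) pairs of ends (a, b), none of which
   sees a vertex outside the path.  Consider all tuples (s, a, b) with s outside the target set,
   and modify s by a switch: the partner of a over an edge {w, w1} of the second cycle is
   exchanged with the partner of an arbitrary vertex x over w1.  Either x lies outside the path
   and a cycle is absorbed, or x is a pivot of a rotation and the tuple becomes (s', y, b), where
   y, the neighbour of x on the path, typically lies over a neighbour g w1 of w1 on the first
   cycle; here g is one of the two orientations of that cycle, and it can be kept fixed because
   pivots may be taken closer and closer to b.  The map is n-to-n up to constants, while a lift in
   the target set has few switches leaving it, as only the few steps of its path over the second
   cycle can be destroyed.  So the number of tuples is essentially preserved, and the fiber of
   the first end performs the walk w -> g w1, which reaches every fiber because the union of the
   two Hamilton cycles is not bipartite.  Once it is next to the fiber of b on the second cycle, a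
   last switch joins the ends and leads to the target set; comparing the numbers of tuples and of
   switches leaving the target set gives the bound, with no independence of the steps needed. *)

Require Import Defs.
From mathcomp Require Import all_boot all_order all_algebra perm.
From mathcomp Require Import boolp classical_sets reals topology normedtype sequences.
From mathcomp Require Import fintype finset fingroup zify.

Set Implicit Arguments.
Unset Strict Implicit.
Unset Printing Implicit Defensive.

(** * Switches *)

Section Switch.
Variables (G : sgraph) (n : nat).
Local Notation lift := {ffun edge G -> 'S_n}.
Implicit Types (s : lift) (u v : G) (i j : 'I_n) (x y z : G * 'I_n).

Lemma edge_neq (e : edge G) : val e != ((val e).2, (val e).1).
Proof.
case: e => -[u v] /= /andP[uv _]; apply/eqP => -[/= uvE _].
by rewrite uvE adj_irrefl in uv.
Qed.

(* The matching read from [u] to [v]; the junk value is 1 on non-adjacent fibers. *)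
Definition fiber_perm s u v : 'S_n :=
  if insub (u, v) is Some e then s e
  else if insub (v, u) is Some e then ((s e)^-1)%g else 1%g.

Lemma edge_asym u v (H : adj u v && (enum_rank u < enum_rank v)) :
  (insub (v, u) : option (edge G)) = None.
Proof. by apply: insubN => /=; case/andP: H => _ /ltnW; rewrite leqNgt => /negbTE->;
  rewrite andbF. Qed.

Lemma fiber_permE s (e : edge G) : fiber_perm s (val e).1 (val e).2 = s e.
Proof. by rewrite /fiber_perm -surjective_pairing valK. Qed.

Lemma fiber_permEV s (e : edge G) : fiber_perm s (val e).2 (val e).1 = (s e)^-1%g.
Proof.
rewrite /fiber_perm -surjective_pairing valK.
by case: e => -[u v] H /=; rewrite edge_asym.
Qed.

Variant adj_edge_spec u v : Prop :=
| AdjEdge (e : edge G) of val e = (u, v)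
| AdjEdgeRev (e : edge G) of val e = (v, u).

Lemma adj_edge u v : adj u v -> adj_edge_spec u v.
Proof.
move=> uv; case: (ltngtP (enum_rank u) (enum_rank v)) => [lt|lt|E].
- have H : adj (u, v).1 (u, v).2 && (enum_rank (u, v).1 < enum_rank (u, v).2) by rewrite uv lt.
  by apply: (@AdjEdge _ _ (Sub (u, v) H)); rewrite SubK.
- have H : adj (v, u).1 (v, u).2 && (enum_rank (v, u).1 < enum_rank (v, u).2)
    by rewrite adj_sym uv lt.
  by apply: (@AdjEdgeRev _ _ (Sub (v, u) H)); rewrite SubK.
- by move/ord_inj/enum_rank_inj: E uv => ->; rewrite adj_irrefl.
Qed.

Lemma edge_adj (e : edge G) : adj (val e).1 (val e).2.
Proof. by case: e => e /= /andP[]. Qed.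

Lemma lift_adjE s x y :
  lift_adj s x y = adj x.1 y.1 && (fiber_perm s x.1 y.1 x.2 == y.2).
Proof.
apply/existsP/andP => [[e /orP[]/andP[/eqP He /eqP Hs]]|[xy /eqP Hs]].
- have := fiber_permE s e; have := edge_adj e; rewrite He /= => -> ->.
  by rewrite Hs eqxx.
- have := fiber_permEV s e; have := edge_adj e; rewrite He /= adj_sym => -> ->.
  by rewrite -Hs permK eqxx.
case: (adj_edge xy) => e He; exists e; rewrite He eqxx /=.
- by have := fiber_permE s e; rewrite He -Hs /= => ->; rewrite eqxx.
- by have := fiber_permEV s e; rewrite He -Hs /= => ->; rewrite permKV eqxx orbT.
Qed.

(** The permutation [r] acts on the fiber of [v] whichever direction of the edge is stored; hence
    the inverse on the left in the second case. *)
Definition twist s u v (r : 'S_n) : lift :=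
  [ffun e => if val e == (u, v) then (s e * r)%g
             else if val e == (v, u) then (r^-1 * s e)%g else s e].

Lemma fiber_perm_twist s u v r : adj u v ->
  fiber_perm (twist s u v r) u v = (fiber_perm s u v * r)%g.
Proof.
move=> uv; case: (adj_edge uv) => e He.
- by have := fiber_permE (twist s u v r) e; have := fiber_permE s e;
    rewrite ffunE He eqxx /= => -> ->.
have := fiber_permEV (twist s u v r) e; have := fiber_permEV s e.
rewrite ffunE; have := edge_neq e; rewrite He eqxx /= => /negbTE -> -> ->.
by rewrite invMg invgK.
Qed.

Lemma fiber_perm_twist_neq s u v r u' v' :
  (u', v') != (u, v) -> (u', v') != (v, u) ->
  fiber_perm (twist s u v r) u' v' = fiber_perm s u' v'.
Proof.
move=> N1 N2; rewrite /fiber_perm.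
case: insubP => [e _ He|_]; first by rewrite ffunE He (negbTE N1) (negbTE N2).
case: insubP => [e _ He|//]; rewrite ffunE He.
by rewrite !xpair_eqE !(andbC (v' == _)) -!xpair_eqE (negbTE N1) (negbTE N2).
Qed.

Lemma twistM s u v r r' : u != v ->
  twist (twist s u v r) u v r' = twist s u v (r * r')%g.
Proof.
move=> uv; apply/ffunP => e; rewrite !ffunE.
case: eqP => [_|_]; first by rewrite mulgA.
by case: eqP => // _; rewrite invMg !mulgA.
Qed.

Lemma twist1 s u v : twist s u v 1 = s.
Proof. by apply/ffunP => e; rewrite ffunE mulg1 invg1 mul1g; do 2?case: eqP. Qed.

(** The vertex [(u, i)] receives the partner [(v, j)], and the former partner of [(v, j)] receives
    that of [(u, i)]. *)
Definition switch s u v i j := twist s u v (tperm (fiber_perm s u v i) j).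

Lemma adj_neq u v : adj u v -> u != v.
Proof. by move=> uv; apply/eqP => E; rewrite E adj_irrefl in uv. Qed.

Lemma switchE s u v i j : adj u v -> fiber_perm (switch s u v i j) u v i = j.
Proof. by move=> uv; rewrite fiber_perm_twist // permM tpermL. Qed.

(** Recording the old partner of [(u, i)] makes a switch reversible; the injections in the double
    counts rest on this. *)
Lemma switchK s u v i j : adj u v ->
  switch (switch s u v i j) u v i (fiber_perm s u v i) = s.
Proof.
move=> uv; rewrite {1}/switch switchE // /switch twistM ?adj_neq //.
by rewrite tpermC tperm2 twist1.
Qed.

Lemma switch_lift_adj s u v i j : adj u v ->
  lift_adj (switch s u v i j) (u, i) (v, j).
Proof. by move=> uv; rewrite lift_adjE /= uv switchE ?eqxx. Qed.

Lemma switch_keep s u v i j x y : adj u v -> lift_adj s x y ->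
  ~~ [&& x.1 == u, y.1 == v & (x == (u, i)) || (y == (v, j))] ->
  ~~ [&& x.1 == v, y.1 == u & (y == (u, i)) || (x == (v, j))] ->
  lift_adj (switch s u v i j) x y.
Proof.
move=> uv.
have key z t : lift_adj s z t -> z.1 = u -> t.1 = v -> z.2 != i -> t.2 != j ->
    lift_adj (switch s u v i j) z t.
  case: z t => [u1 a] [v1 b] /=; rewrite !lift_adjE /= => /andP[_ /eqP Hab] Eu Ev; subst u1 v1.
  move=> ai bj; rewrite uv fiber_perm_twist // permM tpermD ?Hab ?eqxx //; last by rewrite eq_sym.
  by rewrite -Hab (inj_eq perm_inj) eq_sym.
case: (boolP ((x.1 == u) && (y.1 == v))) => [/andP[/eqP xu /eqP yv] xy|N1].
  rewrite xu yv !eqxx /= negb_or => /andP[N1 N2] _; apply: key => //.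
    by apply: contraNneq N1 => <-; rewrite -xu -surjective_pairing.
  by apply: contraNneq N2 => <-; rewrite -yv -surjective_pairing.
case: (boolP ((x.1 == v) && (y.1 == u))) => [/andP[/eqP xv /eqP yu] xy _|N2].
  rewrite xv yu !eqxx /= negb_or => /andP[N2 N3].
  rewrite [X in is_true X](lift_adj_sym (switch s u v i j) x y); apply: key => //.
    - by rewrite lift_adj_sym.
    - by apply: contraNneq N2 => <-; rewrite -yu -surjective_pairing.
  by apply: contraNneq N3 => <-; rewrite -xv -surjective_pairing.
rewrite !lift_adjE => /andP[-> xy] _ _.
by rewrite /switch fiber_perm_twist_neq.
Qed.

End Switch.

(** * Paths and rotations *)

Section Steps.
Variable T : eqType.
Implicit Types (p q : seq T) (x y u v a : T).

Definition steps p : seq (T * T) := if p is x :: q then pairmap pair x q else [::].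

Lemma steps_cat p x q y :
  steps (rcons p y ++ x :: q) = steps (rcons p y) ++ (y, x) :: steps (x :: q).
Proof. by case: p => [|z p] //=; rewrite pairmap_cat last_rcons. Qed.

Lemma steps_cat_cons a p x q :
  steps (a :: p ++ x :: q) = steps (a :: p) ++ (last a p, x) :: steps (x :: q).
Proof. by rewrite -cat_cons lastI steps_cat. Qed.

Lemma steps_rev p : steps (rev p) = rev [seq (z.2, z.1) | z <- steps p].
Proof.
elim: p => [|x [|y p] IHp] //; rewrite rev_cons [rev (y :: p)]rev_cons -cats1 steps_cat.
by rewrite -rev_cons IHp /= !rev_cons -cats1.
Qed.

Lemma sorted_steps e p : sorted e p = all (fun z => e z.1 z.2) (steps p).
Proof. by case: p => //= x p; elim: p x => //= y p IHp x; rewrite IHp. Qed.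

Lemma mem_stepsP p u v :
  reflect (exists p1 p2, p = p1 ++ u :: v :: p2) ((u, v) \in steps p).
Proof.
apply: (iffP idP) => [|[p1 [p2 ->]]].
  elim: p => [|x [|y p] IHp] //=; rewrite inE => /orP[/eqP[-> ->]|/IHp[p1 [p2 E]]].
    by exists [::], p.
  by exists (x :: p1), p2; rewrite E.
case: p1 => [|x p1]; first by rewrite /= inE eqxx.
by rewrite cat_cons steps_cat_cons mem_cat /= !inE eqxx !orbT.
Qed.

Lemma steps_mem p u v : (u, v) \in steps p -> (u \in p) && (v \in p).
Proof. by case/mem_stepsP => p1 [p2 ->]; rewrite !mem_cat !inE !eqxx !orbT. Qed.

Lemma steps_index p u v : uniq p -> (u, v) \in steps p -> index v p = (index u p).+1.
Proof.
move=> Up /mem_stepsP[p1 [p2 E]]; move: Up; rewrite {}E cat_uniq /= negb_or.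
rewrite !inE !negb_or => /and3P[_ /and3P[up vp _] /and3P[/andP[uv _] _ _]].
by rewrite !index_cat (negbTE up) (negbTE vp) /= eqxx (negbTE uv) eqxx addn0 addn1.
Qed.

Lemma steps_inj1 p u v v' : uniq p ->
  (u, v) \in steps p -> (u, v') \in steps p -> v = v'.
Proof.
move=> Up uv uv'; have /andP[_ vp] := steps_mem uv; have /andP[_ vp'] := steps_mem uv'.
by rewrite -(nth_index u vp) -(nth_index u vp') !(steps_index Up uv, steps_index Up uv').
Qed.

Lemma mem_not_head a p x : x \in a :: p -> x != a ->
  exists q1 q2, a :: p = a :: q1 ++ x :: q2.
Proof.
rewrite inE => /orP[/eqP->|]; first by rewrite eqxx.
by case/splitPr => q1 q2 _; exists q1, q2.
Qed.

End Steps.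

(** * Posa rotations and the growth of the set of ends *)

Section Rotation.
Variables (V : finType) (e : rel V).
Implicit Types (p q : seq V) (a x u v : V) (A : {set V}).

(** At most [t] rotations are made, all at the head: [ReachS] lets the counter advance idly, which
    makes the sets of ends monotone in [t]. *)
Inductive reach p : nat -> seq V -> Prop :=
| Reach0 : reach p 0 p
| ReachS t q of reach p t q : reach p t.+1 q
| ReachR t a q1 x q2 of reach p t (a :: q1 ++ x :: q2) & e a x :
    reach p t.+1 (rev (a :: q1) ++ x :: q2).

Definition heads p t : {set V} := [set a | `[< exists q, reach p t (a :: q) >]].

Lemma headsP p t a : reflect (exists q, reach p t (a :: q)) (a \in heads p t).
Proof. by rewrite inE; apply: asboolP. Qed.

Lemma heads_sub p t : heads p t \subset heads p t.+1.
Proof.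
by apply/subsetP => a /headsP[q pq]; apply/headsP; exists q; apply: ReachS.
Qed.

Lemma reach_perm p t q : reach p t q -> perm_eq q p.
Proof.
elim=> {t q} [||t a q1 x q2 _ IH _] //.
by apply: perm_trans IH; rewrite -cat_cons perm_cat2r perm_rev.
Qed.

Lemma reach_last p t q x0 : reach p t q -> last x0 q = last x0 p.
Proof. by elim=> {t q} [||t a q1 x q2 _ <- _] //; rewrite -cat_cons !last_cat. Qed.

Definition path_nb p u v := ((u, v) \in steps p) || ((v, u) \in steps p).

Definition path_nbs p A : {set V} := [set v | [exists u in A, path_nb p u v]].

Lemma path_nbsP p A v :
  reflect (exists2 u, u \in A & path_nb p u v) (v \in path_nbs p A).
Proof. by rewrite inE; apply: exists_inP. Qed.

Lemma path_nbsS p A (B : {set V}) : A \subset B -> path_nbs p A \subset path_nbs p B.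
Proof.
move=> /subsetP AB; apply/subsetP => v /path_nbsP[u uA uv].
by apply/path_nbsP; exists u; rewrite ?AB.
Qed.

Lemma card_path_nbs p A : uniq p -> #|path_nbs p A| <= 2 * #|A|.
Proof.
move=> Up; pose nx u := nth u p (index u p).+1; pose pv u := nth u p (index u p).-1.
have sub : path_nbs p A \subset (nx @: A) :|: (pv @: A).
  apply/subsetP => v /path_nbsP[u uA /orP[]uv]; rewrite inE; apply/orP; [left|right];
    have /andP[p1 p2] := steps_mem uv; apply/imsetP; exists u => //.
    by rewrite /nx -(steps_index Up uv) nth_index.
  by rewrite /pv (steps_index Up uv) nth_index.
apply: (leq_trans (subset_leq_card sub)); apply: (leq_trans (leq_card_setU _ _)).
by rewrite mul2n -addnn leq_add ?leq_imset_card.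
Qed.

(** A rotation creates only the step from the old end to the pivot [x]. If the step broken at [x]
    belonged to [p], then [x] is next on [p] to the new end; otherwise induction already places
    [x]. *)
Lemma reach_steps p t q u v : reach p t q -> (u, v) \in steps q ->
  path_nb p u v \/
  (u \in heads p t :|: path_nbs p (heads p t)) /\
  (v \in heads p t :|: path_nbs p (heads p t)).
Proof.
move=> R; elim: R u v => {t q} [u v uv|t q _ IH u v /IH|t a q1 x q2 R IH ax u v].
- by left; rewrite /path_nb uv.
- case=> [|[uP vP]]; [by left | right].
  have sub := subsetP (setUSS (heads_sub p t) (path_nbsS p (heads_sub p t))).
  by rewrite !sub.
have S1 := subsetP (heads_sub p t).
have sub := subsetP (setUSS (heads_sub p t) (path_nbsS p (heads_sub p t))).
have aH : a \in heads p t.+1 by apply/S1/headsP; exists (q1 ++ x :: q2).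
have yH : last a q1 \in heads p t.+1.
  apply/headsP; exists (rev (belast a q1) ++ x :: q2).
  by have := ReachR R ax; rewrite lastI rev_rcons.
have old u' v' : (u', v') \in steps (a :: q1 ++ x :: q2) ->
  path_nb p u' v' \/
  (u' \in heads p t.+1 :|: path_nbs p (heads p t.+1)) /\
  (v' \in heads p t.+1 :|: path_nbs p (heads p t.+1)).
  by move/IH => [|[uP vP]]; [left | right; rewrite !sub].
have xH : x \in heads p t.+1 :|: path_nbs p (heads p t.+1).
  have /old[yx|[]//] : (last a q1, x) \in steps (a :: q1 ++ x :: q2).
    by rewrite steps_cat_cons mem_cat !inE eqxx orbT.
  by rewrite inE; apply/orP; right; apply/path_nbsP; exists (last a q1).
rewrite rev_cons steps_cat -rev_cons mem_cat inE => /or3P[uv|/eqP[-> ->]|uv].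
- have /old : (v, u) \in steps (a :: q1 ++ x :: q2).
    rewrite steps_cat_cons mem_cat; apply/orP; left.
    move: uv; rewrite steps_rev mem_rev => /mapP[[u' v'] H [-> ->]].
    exact: H.
  by rewrite /path_nb orbC => -[|[]]; [left | right].
- by right; rewrite xH inE aH.
- by apply: old; rewrite steps_cat_cons mem_cat inE uv !orbT.
Qed.

Definition nbhd A : {set V} := [set v | [exists u in A, e u v]].

(** A neighbour [x] of an end is a possible pivot, and rotating there makes its predecessor an end.
    By [reach_steps], if [x] is not an end itself, it is next on the original path to some element
    of [heads p t.+1], and each of these has at most two path neighbours. *)
Lemma heads_growth p t : uniq p ->
  (forall a q x, reach p t (a :: q) -> e a x -> x \in p) ->
  #|nbhd (heads p t) :\: heads p t| <= 2 * #|heads p t.+1|.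
Proof.
move=> Up clos; apply: leq_trans (card_path_nbs (heads p t.+1) Up).
apply/subset_leq_card/subsetP => x; rewrite !inE => /andP[xH /exists_inP[a]].
rewrite inE => /asboolP[q R] ax.
have xq : x \in a :: q by rewrite (perm_mem (reach_perm R)) (clos _ _ _ R ax).
have xa : x != a by apply: contraNneq xH => ->; apply/asboolP; exists q.
have [q1 [q2 [E]]] := mem_not_head xq xa.
rewrite E in R; have yH : last a q1 \in heads p t.+1.
  apply/headsP; exists (rev (belast a q1) ++ x :: q2).
  by have := ReachR R ax; rewrite lastI rev_rcons.
have : (last a q1, x) \in steps (a :: q1 ++ x :: q2).
  by rewrite steps_cat_cons mem_cat !inE eqxx orbT.
case/(reach_steps R) => [yx|[_]]; first by apply/exists_inP; exists (last a q1).
rewrite inE => /orP[|/(subsetP (path_nbsS p (heads_sub p t)))].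
  by rewrite inE (negbTE xH).
by rewrite inE.
Qed.

(** While there are at most [M] ends, the expansion by 9/4 and the factor 2 lost in [heads_growth]
    multiply their number by at least 9/8 per rotation. *)
Lemma heads_large p a0 p' M D : p = a0 :: p' -> uniq p -> 8 ^ D * M < 9 ^ D ->
  (forall A, 0 < #|A| <= M -> 9 * #|A| <= 4 * #|nbhd A :\: A|) ->
  (forall a q x, reach p D (a :: q) -> e a x -> x \in p) ->
  M < #|heads p D|.
Proof.
move=> Ep Up HD exp clos.
have mono t t' : t <= t' -> heads p t \subset heads p t'.
  elim: t' => [|t' IH]; first by rewrite leqn0 => /eqP->.
  rewrite leq_eqVlt => /predU1P[->//|]; rewrite ltnS => /IH/subset_trans; apply.
  exact: heads_sub.
have reach_mono t t' q : t <= t' -> reach p t q -> reach p t' q.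
  elim: t' => [|t' IH]; first by rewrite leqn0 => /eqP->.
  by rewrite leq_eqVlt => /predU1P[->//|]; rewrite ltnS => /IH H /H; apply: ReachS.
have pos t : 0 < #|heads p t|.
  apply/card_gt0P; exists a0; apply: (subsetP (mono 0 t isT)).
  by apply/headsP; exists p'; rewrite -Ep; apply: Reach0.
rewrite ltnNge; apply/negP => small.
suff: 9 ^ D <= 8 ^ D * #|heads p D|.
  by move=> H; have := leq_trans H (leq_mul (leqnn (8 ^ D)) small); rewrite leqNgt HD.
have: forall t, t <= D -> 9 ^ t <= 8 ^ t * #|heads p t|.
  elim=> [|t IH] tD; first by rewrite !expn0 mul1n pos.
  have := IH (ltnW tD).
  have := exp (heads p t); rewrite pos (leq_trans (subset_leq_card (mono _ _ (ltnW tD))) small).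
  move=> /(_ isT).
  have := @heads_growth p t Up (fun a q x R => clos a q x (reach_mono _ _ _ (ltnW tD) R)).
  by rewrite !expnS; nia.
exact.
Qed.

End Rotation.

(** * Paths covering all but a few lifted cycles *)

Lemma eq_card_froots (T : finType) (f f' : T -> T) (P : pred T) : f =1 f' ->
  #|[set x | froots f x && P x]| = #|[set x | froots f' x && P x]|.
Proof. by move=> E; apply: eq_card => x; rewrite !inE (eq_froots E). Qed.

Section Cover.
Variables (G : sgraph) (n : nat) (c1 c2 : seq G).
Hypothesis ham1 : hamilton_cycle c1.
Local Notation V := (G * 'I_n)%type.
Local Notation lift := {ffun edge G -> 'S_n}.
Implicit Types (s : lift) (u v w : G) (i j : 'I_n) (x y a b : V) (p : seq V).

Lemma ham_uniq c : hamilton_cycle (G := G) c -> uniq c.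
Proof. by case/and3P => _ /andP[]. Qed.

Lemma ham_mem c u : hamilton_cycle (G := G) c -> u \in c.
Proof. by case/and3P => _ _ /forallP. Qed.

Lemma ham_edge c u v : hamilton_cycle c ->
  cycle_edge c u v = (v == next c u) || (u == next c v).
Proof. by move=> H; rewrite /cycle_edge !ham_mem. Qed.

Lemma ham_adj c u v : hamilton_cycle c -> cycle_edge c u v -> adj u v.
Proof.
move=> H; rewrite ham_edge //; have /and3P[_ /andP[cyc _] _] := H.
case/orP => /eqP->; last rewrite adj_sym;
  by apply: (next_cycle cyc); apply: ham_mem.
Qed.

Lemma ham_edge_sym c u v : hamilton_cycle (G := G) c -> cycle_edge c u v = cycle_edge c v u.
Proof. by move=> H; rewrite !ham_edge // orbC. Qed.

Lemma ham_next_inj c : hamilton_cycle (G := G) c -> injective (next c).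
Proof. by move=> H; apply: can_inj (prev_next (ham_uniq H)). Qed.

Lemma ham_next2 c u : hamilton_cycle (G := G) c -> next c (next c u) != u.
Proof.
move=> H; apply/eqP; have := ham_mem u H; have := ham_uniq H.
have /and3P[+ _ _] := H => sz Uc uc.
have [i c' E] := rot_to uc; rewrite -!(next_rot i Uc) E.
have : uniq (u :: c') by rewrite -E rot_uniq.
have : 2 < size (u :: c') by rewrite -E size_rot.
case: c' {E} => [|v [|w c']] //= _; rewrite !inE !negb_or -!andbA => /and5P[uv uw _ vw _].
by rewrite eqxx [v == u]eq_sym (negbTE uv) eqxx => E; rewrite E eqxx in uw.
Qed.

Lemma ham_connect c u v : hamilton_cycle (G := G) c -> fconnect (next c) u v.
Proof.
move=> H; rewrite (fconnect_cycle (cycle_next (ham_uniq H))) ?ham_mem //.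
Qed.

Local Notation h1 := (cycle_edge c1).
Local Notation h2 := (cycle_edge c2).

Definition hsucc s x : V := (next c1 x.1, fiber_perm s x.1 (next c1 x.1) x.2).

Lemma hsucc_adj s x : lift_adj s x (hsucc s x).
Proof.
rewrite lift_adjE /= eqxx andbT; apply: (ham_adj ham1).
by rewrite ham_edge // eqxx.
Qed.

Lemma hsucc_inj s : injective (hsucc s).
Proof.
move=> [u i] [v j] [/= /(ham_next_inj ham1) E]; rewrite -{v}E in j *.
by move/perm_inj->.
Qed.

Definition cost p := count (fun z : V * V => ~~ h1 z.1.1 z.2.1) (steps p).

(** The path is a union of whole lifted cycles, so the vertices off it form the remaining ones;
    these are counted by their canonical roots. *)
Definition path_cover s c q p :=
  [/\ uniq p, sorted (lift_adj s) p, forall x, (hsucc s x \in p) = (x \in p),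
      #|[set x | froots (hsucc s) x && (x \notin p)]| <= c & cost p <= q].

Lemma cost_rev p : cost (rev p) = cost p.
Proof.
rewrite /cost steps_rev count_rev count_map; apply: eq_count => z /=.
by rewrite (ham_edge_sym _ _ ham1).
Qed.

Lemma path_cover_rev s c q p : path_cover s c q p -> path_cover s c q (rev p).
Proof.
case=> Up Sp Cp Np Qp; split; rewrite ?rev_uniq ?cost_rev //.
- rewrite rev_sorted; move: Sp; rewrite (@eq_sorted _ _ (fun x y => lift_adj s y x)) //.
  by move=> x y; rewrite lift_adj_sym.
- by move=> x; rewrite !mem_rev.
- by under eq_finset => x do rewrite mem_rev.
Qed.

Lemma path_cover_mono s c q c' q' p : c <= c' -> q <= q' ->
  path_cover s c q p -> path_cover s c' q' p.
Proof. by move=> cc qq [? ? ? H1 H2]; split=> //; [apply: leq_trans cc|apply: leq_trans qq]. Qed.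

Lemma path_cover_perm s c q q' p p' : perm_eq p' p -> sorted (lift_adj s) p' ->
  cost p' <= q' -> path_cover s c q p -> path_cover s c q' p'.
Proof.
move=> E Sp' cp' [Up Sp Cp Np Qp]; have M := perm_mem E; split=> //.
- by rewrite (perm_uniq E).
- by move=> x; rewrite !M.
- by under eq_finset => x do rewrite M.
Qed.

Lemma cost_cat_cons a p x p' :
  cost (a :: p ++ x :: p') = cost (a :: p) + (~~ h1 (last a p).1 x.1 + cost (x :: p')).
Proof. by rewrite /cost steps_cat_cons count_cat. Qed.

Lemma cost_cat_rcons p a x p' :
  cost (rcons p a ++ x :: p') = cost (rcons p a) + (~~ h1 a.1 x.1 + cost (x :: p')).
Proof. by rewrite /cost steps_cat count_cat. Qed.

Lemma path_cover_rot s c q a (q1 : seq V) x q2 : path_cover s c q (a :: q1 ++ x :: q2) ->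
  lift_adj s a x -> path_cover s c q.+1 (rev (a :: q1) ++ x :: q2).
Proof.
move=> H ax; have [Up Sp _ _ Qp] := H; apply: path_cover_perm H.
- by rewrite -cat_cons perm_cat2r perm_rev.
- move: Sp; rewrite !sorted_steps steps_cat_cons rev_cons steps_cat -rev_cons !all_cat /=.
  case/and3P => S1 _ ->; rewrite ax andbT /=.
  rewrite andbT steps_rev all_rev all_map; apply: sub_all S1 => z /=; by rewrite lift_adj_sym.
- move: Qp; rewrite rev_cons cost_cat_rcons cost_cat_cons -rev_cons cost_rev.
  by clear; do 2!case: (~~ _) => /=; lia.
Qed.

Lemma path_cover_reach s c q p t p' : path_cover s c q p ->
  reach (lift_adj s) p t p' -> path_cover s c (q + t) p'.
Proof.
move=> H; elim=> {t p'} [|t p' _ IH|t a q1 x q2 _ IH ax]; rewrite ?addn0 ?addnS //.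
  by apply: path_cover_mono IH.
by apply: path_cover_rot.
Qed.

Lemma steps_traject (T : eqType) (f : T -> T) d m (x y : T) :
  (x, y) \in steps (traject f d m) -> y = f x.
Proof.
elim: m d => //= -[|m] IH d //=; rewrite inE => /orP[/eqP[-> ->]//|].
by move=> H; apply: (IH (f d)).
Qed.

Lemma sorted_orbit s x : sorted (lift_adj s) (orbit (hsucc s) x).
Proof.
rewrite sorted_steps; apply/allP => -[y z] /steps_traject -> /=; exact: hsucc_adj.
Qed.

Lemma cost_orbit s x : cost (orbit (hsucc s) x) = 0.
Proof.
apply/eqP; rewrite -leqn0 leqNgt -has_count; apply/hasPn => -[y z] /steps_traject ->.
by rewrite /= negbK ham_edge // eqxx.
Qed.

Lemma hsucc_connect s p x y : (forall x, (hsucc s x \in p) = (x \in p)) ->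
  fconnect (hsucc s) x y -> (y \in p) = (x \in p).
Proof.
move=> Cp /connectP[r + ->]; elim: r x => //= z r IH x /andP[/eqP<- /IH->].
exact: Cp.
Qed.

(** The lifted cycle through [d] is traversed backwards so as to end at [d], and put in front of
    [a]; only the step from [d] to [a] may cost. *)
Lemma path_cover_swallow s c q a p d : path_cover s c.+1 q (a :: p) ->
  lift_adj s a d -> d \notin a :: p ->
  exists a' p', path_cover s c q.+1 (a' :: p').
Proof.
move=> [Up Sp Cp Np Qp] ad dp; pose f := hsucc s.
have fsym := fconnect_sym (@hsucc_inj s).
have orb_out x : x \in orbit f d -> x \notin a :: p.
  by rewrite -fconnect_orbit => /(hsucc_connect Cp) ->.
have Er : exists r, orbit f d = d :: r.
  by exists (traject f (f d) (fingraph.order f d).-1); rewrite /orbit -orderSpred.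
have : path_cover s c q.+1 (rev (orbit f d) ++ a :: p).
  split.
  - rewrite cat_uniq rev_uniq orbit_uniq Up andbT; apply/hasPn => x xp.
    by rewrite /= mem_rev; apply: contraL xp => /orb_out.
  - case: Er => r E; move: Sp; rewrite !sorted_steps E rev_cons steps_cat -rev_cons -E all_cat /=.
    move=> ->; rewrite lift_adj_sym ad /= andbT steps_rev all_rev all_map.
    have := sorted_orbit s d; rewrite sorted_steps; apply: sub_all => z /=.
    by rewrite lift_adj_sym.
  - move=> x; rewrite !mem_cat !mem_rev Cp; congr orb.
    rewrite -!fconnect_orbit; apply: (same_connect_r fsym).
    by rewrite fsym fconnect1.
  - rewrite -ltnS; apply: leq_trans Np.
    rewrite [X in _ < X](cardsD1 (froot f d)) inE (roots_root fsym).
    rewrite (hsucc_connect Cp (connect_root _ d : fconnect (hsucc s) d _)) dp /=.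
    apply/subset_leq_card/subsetP => x; rewrite !inE mem_cat mem_rev negb_or.
    case/and3P => xr xo ->; rewrite xr !andbT; apply: contraNneq xo => ->.
    by rewrite -fconnect_orbit connect_root.
  - case: Er => r E; rewrite E rev_cons cost_cat_rcons -rev_cons -E cost_rev cost_orbit.
    by move: Qp; clear; case: (~~ _) => /=; lia.
case: Er => r ->; case E: (rev (d :: r)) => [|a' r'] /=; first by exists a, p.
by exists a', (r' ++ a :: p).
Qed.

Lemma path_cover_full s q p x : path_cover s 0 q p -> x \in p.
Proof.
case=> _ _ Cp; rewrite leqn0 cards_eq0 => /eqP Np _.
have fsym := fconnect_sym (@hsucc_inj s).
apply: contraT => xp; have := in_set0 (froot (hsucc s) x).
rewrite -Np inE (roots_root fsym).
by rewrite (hsucc_connect Cp (connect_root _ x : fconnect (hsucc s) x _)) xp.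
Qed.

(** The adjacent ends close the path into a cycle, which is reopened so as to start at [x]; closing
    and swallowing cost at most one step each. *)
Lemma path_cover_merge s c q a p x d : path_cover s c.+1 q (a :: p) ->
  lift_adj s (last a p) a -> x \in a :: p -> lift_adj s x d -> d \notin a :: p ->
  exists a' p', path_cover s c q.+2 (a' :: p').
Proof.
move=> H ba xp xd dp.
suff [r [r1 r2]]: exists r, path_cover s c.+1 q.+1 (x :: r) /\ perm_eq (x :: r) (a :: p).
  by apply: path_cover_swallow r1 xd _; rewrite (perm_mem r2).
case: (x =P a) => [->|/eqP xa]; first by exists p; split=> //; apply: path_cover_mono H.
have [q1 [q2 [E]]] := mem_not_head xp xa.
have EE : perm_eq (x :: q2 ++ a :: q1) (a :: p) by rewrite E -!cat_cons perm_catC.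
exists (q2 ++ a :: q1); split=> //; apply: (path_cover_perm EE _ _ H).
  case: H => _ + _ _ _; rewrite E !sorted_steps !steps_cat_cons !all_cat /= => /and3P[-> _ ->].
  by move: ba; rewrite E last_cat /= => ->.
case: H => _ _ _ _; rewrite E !cost_cat_cons.
by clear; do 2!case: (~~ _) => /=; lia.
Qed.

Lemma path_cover_hamiltonian s q a p : path_cover s 0 q (a :: p) ->
  lift_adj s (last a p) a -> hamiltonian (lift_graph s).
Proof.
move=> H ba; exists (a :: p); have [Up Sp _ _ _] := H; apply/and3P; split.
- have /and3P[+ _ _] := ham1 => sz.
  have := max_card (mem (a :: p)); rewrite (card_uniqP Up) => _.
  apply: leq_trans sz _.
  (* The copies of the vertices of [c1] with index [a.2] show that the lift has more than two
     vertices. *)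
  have -> : size c1 = #|[seq (u, a.2) | u <- c1]|.
    by rewrite (card_uniqP _) ?size_map // map_inj_uniq ?ham_uniq // => u v [].
  by rewrite -(card_uniqP Up); apply/subset_leq_card/subsetP => x _; apply: path_cover_full H.
- by rewrite /ucycleb Up andbT /= rcons_path ba andbT.
- by apply/forallP => x; apply: path_cover_full H.
Qed.

(** The ends of the costly steps: a switch over the second cycle can harm the path only at these
    vertices. *)
Definition touched p : {set V} :=
  [set x | has (fun z : V * V => ~~ h1 z.1.1 z.2.1 && ((z.1 == x) || (z.2 == x))) (steps p)].

Lemma card_touched p : #|touched p| <= 2 * cost p.
Proof.
pose l := [seq z <- steps p | ~~ h1 z.1.1 z.2.1].
have -> : 2 * cost p = size ([seq z.1 | z <- l] ++ [seq z.2 | z <- l]).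
  by rewrite size_cat !size_map size_filter -/(cost p) addnn mul2n.
apply: leq_trans (card_size _); apply/subset_leq_card/subsetP => x.
rewrite inE => /hasP[z zp /andP[hz /orP[]/eqP<-]]; rewrite mem_cat; apply/orP; [left|right];
  by apply/mapP; exists z => //; rewrite mem_filter hz.
Qed.

Lemma touchedP p x y : (x, y) \in steps p -> h1 x.1 y.1 \/ (x \in touched p) && (y \in touched p).
Proof.
move=> xy; case: (boolP (h1 _ _)) => h; [by left|right]; rewrite !inE.
by apply/andP; split; apply/hasP; exists (x, y); rewrite //= h eqxx ?orbT.
Qed.

Hypotheses (ham2 : hamilton_cycle c2) (disj : edge_disjoint c1 c2).

Lemma h2_adj u v : h2 u v -> adj u v. Proof. exact: ham_adj. Qed.

Lemma h2_h1 u v : h2 u v -> h1 u v = false.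
Proof. by move=> H; apply/negbTE; have := disj u v; rewrite H andbT. Qed.

Lemma switch_hsucc s u v i j : h2 u v -> hsucc (switch s u v i j) =1 hsucc s.
Proof.
move=> uv x; rewrite /hsucc /switch fiber_perm_twist_neq //.
  by apply/eqP => -[xu xv]; move: (h2_h1 uv); rewrite ham_edge // -xv xu eqxx.
by apply/eqP => -[xv xu]; move: (h2_h1 uv); rewrite ham_edge // -xu xv eqxx orbT.
Qed.

Lemma path_cover_switch s u v i j c q p : h2 u v -> path_cover s c q p ->
  (forall x y, (x, y) \in steps p ->
    ~~ [&& x.1 == u, y.1 == v & (x == (u, i)) || (y == (v, j))] /\
    ~~ [&& x.1 == v, y.1 == u & (y == (u, i)) || (x == (v, j))]) ->
  path_cover (switch s u v i j) c q p.
Proof.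
move=> uv [Up Sp Cp Np Qp] K; have E := switch_hsucc s i j uv.
split; [exact: Up| | | |exact: Qp].
- move: Sp; rewrite !sorted_steps => /allP Sp; apply/allP => -[x y] xy.
  by have [K1 K2] := K _ _ xy; apply: switch_keep => //; [apply: h2_adj | apply: (Sp _ xy)].
- by move=> x; rewrite E.
- by rewrite (eq_card_froots _ E).
Qed.

Lemma path_cover_touched s u v i j c q p : h2 u v -> path_cover s c q p ->
  (u, i) \notin touched p -> (v, j) \notin touched p ->
  path_cover (switch s u v i j) c q p.
Proof.
move=> uv H ui vj; apply: path_cover_switch H _ => // x y /touchedP[h|/andP[xt yt]]; split.
- by apply/negP => /and3P[/eqP xu /eqP yv _]; rewrite xu yv h2_h1 in h.
- by apply/negP => /and3P[/eqP xu /eqP yv _]; rewrite xu yv (ham_edge_sym _ _ ham1) h2_h1 in h.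
- by apply/negP => /and3P[_ _ /orP[]/eqP E]; [rewrite -E xt in ui | rewrite -E yt in vj].
- by apply/negP => /and3P[_ _ /orP[]/eqP E]; [rewrite -E yt in ui | rewrite -E xt in vj].
Qed.

End Cover.

(** * Double counting of switches *)

Lemma card_dep (T U : finType) (A : {set T}) (J : T -> {set U}) :
  #|[set z : T * U | (z.1 \in A) && (z.2 \in J z.1)]| = \sum_(t in A) #|J t|.
Proof.
under eq_bigr => t _ do rewrite -sum1_card.
rewrite pair_big_dep /= -sum1_card; apply: eq_bigl => z; by rewrite inE.
Qed.

Lemma card_dep_ge (T U : finType) (A : {set T}) (J : T -> {set U}) P :
  (forall t, t \in A -> P <= #|J t|) ->
  #|A| * P <= #|[set z : T * U | (z.1 \in A) && (z.2 \in J z.1)]|.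
Proof. by move=> H; rewrite -sum_nat_const card_dep; apply: leq_sum. Qed.

Lemma card_dep_le (T U : finType) (A : {set T}) (J : T -> {set U}) P :
  (forall t, t \in A -> #|J t| <= P) ->
  #|[set z : T * U | (z.1 \in A) && (z.2 \in J z.1)]| <= #|A| * P.
Proof. by move=> H; rewrite -sum_nat_const card_dep; apply: leq_sum. Qed.

(** * Orientations of the first cycle and turns of a path *)

Section Orientation.
Variables (G : sgraph) (c1 : seq G).
Hypothesis ham1 : hamilton_cycle c1.
Implicit Types (u v : G) (g : G -> G).

Definition orientation g :=
  [/\ injective g, forall u v, cycle_edge c1 u v = (v == g u) || (u == g v),
      forall u, g (g u) != u & forall u v, fconnect g u v].

Lemma orientation_next : orientation (next c1).
Proof.
split; [exact: ham_next_inj|by move=> u v; apply: ham_edge | by move=> u; apply: ham_next2|].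
by move=> u v; apply: ham_connect.
Qed.

Lemma orientation_prev : orientation (prev c1).
Proof.
have U := ham_uniq ham1; have np := next_prev U; have pn := prev_next U.
split.
- exact: can_inj np.
- move=> u v; rewrite ham_edge // orbC; congr orb; apply/eqP/eqP => ->; by rewrite ?np ?pn.
- by move=> u; apply: contraNneq (ham_next2 u ham1) => {1}<-; rewrite !np.
move=> u v; rewrite -(eq_fconnect (finv_eq_can pn)).
by rewrite (same_fconnect_finv (can_inj pn)) ham_connect.
Qed.

End Orientation.

Section Turns.
Variables (G : sgraph) (n : nat) (c1 : seq G).
Local Notation V := (G * 'I_n)%type.
Local Notation lift := {ffun edge G -> 'S_n}.
Implicit Types (s : lift) (u v w : G) (g : G -> G) (x y : V) (p : seq V).

Lemma lift_adj_inj s x y z : lift_adj s x y -> lift_adj s x z -> y.1 = z.1 -> y = z.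
Proof.
case: y z => [y1 y2] [z1 z2]; rewrite !lift_adjE /= => /andP[_ /eqP<-] /andP[_ /eqP<-] E.
by rewrite E.
Qed.

(* Rotating at a vertex [x] counted here moves the end of the path to the fiber [g u]. *)
Definition turns g u p :=
  count (fun z : V * V => (z.1.1 == g u) && (z.2.1 == u)) (steps p).

Lemma turns_suffix g u p x p' : turns g u (x :: p') <= turns g u (p ++ x :: p').
Proof.
case: p => [|a p] //=; rewrite /turns -[a :: _]/(a :: p ++ x :: p') steps_cat_cons count_cat /=.
by rewrite addnA leq_addl.
Qed.

(** A step from the fiber [g (g u)] to [g u] cannot be followed by a step back, as a vertex has a
    single neighbour in each adjacent fiber; so the path goes on to [u], makes a costly step, or
    ends. The flag [back] marks a vertex over [g u] with no neighbour over [g (g u)] left ahead,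
    which still owes one of the three. *)
Lemma turns_step g s u p : orientation c1 g -> uniq p -> sorted (lift_adj s) p ->
  turns g (g u) p <= turns g u p + (cost c1 p).+1.
Proof.
move=> [ginj gE gg _]; pose back x r := (x.1 == g u) &&
  ~~ has (fun z => lift_adj s x z && (z.1 == g (g u))) r.
suff key x r : uniq (x :: r) -> path (lift_adj s) x r ->
    back x r + turns g (g u) (x :: r) <= turns g u (x :: r) + (cost c1 (x :: r)).+1.
  by case: p => [|x r] // U S; apply: leq_trans (key x r U S); apply: leq_addl.
have gn v : g v != v by apply/eqP => E; move: (gg v); rewrite !E eqxx.
elim: r x => [|x' r IH] x; first by case: (back x _).
rewrite [uniq _]/= => /andP[xr Ur] /= /andP[xx' S]; move: (IH x' Ur S).
rewrite /turns /cost /= -/(turns g u (x' :: r)) -/(turns g (g u) (x' :: r)) -/(cost c1 (x' :: r)).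
case: (boolP ((x.1 == g (g u)) && (x'.1 == g u))) => [/andP[/eqP xu /eqP xu']|_].
  have -> : back x (x' :: r) = false by rewrite /back xu (negbTE (gn _)).
  have -> : back x' r.
    rewrite /back xu' eqxx /=; apply/hasPn => z zr; apply/negP => /andP[az /eqP zu].
    have zx : z = x by apply: (@lift_adj_inj s x'); rewrite ?zu ?xu // lift_adj_sym.
    by move: xr; rewrite inE -zx zr orbT.
  by clear; case: ((x.1 == g u) && _); case: (~~ _) => /=; lia.
case: (boolP (back x (x' :: r))) => [|_]; last first.
  by case: (back x' r); clear; case: ((x.1 == g u) && _); case: (~~ _) => /=; lia.
rewrite /back /= negb_or => /andP[/eqP xu /andP[nx _]].
rewrite gE xu; case: (boolP (g u == g x'.1)) => [/eqP/ginj<-|_].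
  by rewrite orbT /= !eqxx; case: (back x' r); clear => /=; lia.
rewrite orbF; move: nx; rewrite xx' /= => /negbTE->.
by rewrite eqxx; case: (back x' r); clear; case: (x'.1 == u) => /=; lia.
Qed.

Lemma turns_comparable g s u v p : orientation c1 g -> uniq p -> sorted (lift_adj s) p ->
  turns g v p <= turns g u p + #|G| * (cost c1 p).+1.
Proof.
move=> og Up Sp; have [_ _ _ /(_ u v) uv] := og.
have leG : findex g u v <= #|G|.
  by apply: ltnW; apply: leq_trans (findex_max uv) (max_card _).
rewrite -(iter_findex uv); apply: leq_trans (_ : _ <=
  turns g u p + findex g u v * (cost c1 p).+1) _.
  elim: (findex g u v) => [|m IH]; first by rewrite addn0.
  by have := turns_step (iter m g u) og Up Sp; rewrite /= mulSn; lia.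
by rewrite leq_add2l leq_mul2r leG orbT.
Qed.

(** Discarding the last [h] turns leaves pivots with [h] turns still ahead of them, the reserve for
    later moves. *)
Lemma pivots g w h p : uniq p -> exists A : {set V}, turns g w p - h <= #|A| /\
  forall x, x \in A -> exists p1 y p2, [/\ p = rcons p1 y ++ x :: p2,
    y.1 = g w, x.1 = w & h <= turns g w (x :: p2)].
Proof.
elim: p => [|a p IH]; first by exists set0; rewrite cards0; split=> // x; rewrite inE.
move=> /= /andP[_ /[dup] Up /IH[A [cA HA]]] {IH}.
have ext x : x \in A -> exists p1 y p2, [/\ a :: p = rcons p1 y ++ x :: p2,
    y.1 = g w, x.1 = w & h <= turns g w (x :: p2)].
  by case/HA => p1 [y [p2 [-> ? ? ?]]]; exists (a :: p1), y, p2.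
case: p Up cA HA ext => [|b p] Up cA HA ext; first by exists A; split.
have Et : turns g w (a :: b :: p) = (a.1 == g w) && (b.1 == w) + turns g w (b :: p) by [].
case: (boolP ((a.1 == g w) && (b.1 == w))) Et => [/andP[/eqP aw /eqP bw]|_] /= Et;
  last by exists A; rewrite Et add0n.
have [hb|hb] := leqP h (turns g w (b :: p)); last first.
  by exists set0; split=> [|x]; [rewrite Et; lia | rewrite inE].
have bA : b \notin A.
  apply/negP => /HA[p1 [y [p2 [E _ _ _]]]]; move: Up; rewrite E.
  by case: p1 E => [|z p1] [<- _]; rewrite cat_uniq /= inE eqxx ?orbT /= ?andbF.
exists (b |: A); rewrite cardsU1 bA; split; first by rewrite Et; lia.
move=> x; rewrite in_setU1 => /predU1P[->|/ext//].
by exists [::], a, p.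
Qed.

End Turns.

(** * Transfer of tuples along switches *)

Section Transfer.
Variables (G : sgraph) (n : nat) (c1 c2 : seq G).
Hypotheses (ham1 : hamilton_cycle c1) (ham2 : hamilton_cycle c2).
Hypothesis disj : edge_disjoint c1 c2.
Local Notation V := (G * 'I_n)%type.
Local Notation lift := {ffun edge G -> 'S_n}.
Local Notation h1 := (cycle_edge c1).
Local Notation h2 := (cycle_edge c2).
Implicit Types (s : lift) (u v w z : G) (i j l : 'I_n) (x y a b : V) (p : seq V).

(** While lifted cycles are missing, closing the path helps only if some edge leaves it; for [c = 0]
    closing it finishes the proof. *)
Definition linked s c p :=
  c = 0 \/ exists x d, [/\ x \in p, d \notin p & lift_adj s x d].

Variables (X : {set lift}) (c Qmax beta : nat).
Hypothesis X_swallow : forall s a p d,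
  path_cover c1 s c Qmax (a :: p) -> lift_adj s a d -> d \notin a :: p -> s \in X.
Hypothesis X_close : forall s a p, path_cover c1 s c Qmax (a :: p) ->
  lift_adj s (last a p) a -> linked s c (a :: p) -> s \in X.
Hypothesis X_robust : forall s, s \in X -> exists B : {set V}, #|B| <= beta /\
  forall u v i j, h2 u v -> (u, i) \notin B -> (v, j) \notin B ->
  switch s u v i j \in X.

(** A switch that leaves [X] has [(u, i)] or [(v, j)] in the exceptional set of [X_robust], which
    allows at most [2 * beta * n] pairs [(i, j)] for each lift. *)
Lemma card_leave u v : h2 u v ->
  #|[set t : lift * 'I_n * 'I_n | (t.1.1 \in X) && (switch t.1.1 u v t.1.2 t.2 \notin X)]|
    <= #|X| * (2 * beta * n).
Proof.
move=> uv; pose E : {set lift * ('I_n * 'I_n)} :=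
  [set t | (t.1 \in X) && (switch t.1 u v t.2.1 t.2.2 \notin X)].
have -> : #|[set t : lift * 'I_n * 'I_n | (t.1.1 \in X) &&
  (switch t.1.1 u v t.1.2 t.2 \notin X)]| = #|E|.
  have inj : injective (fun t : lift * ('I_n * 'I_n) => (t.1, t.2.1, t.2.2)).
    by move=> [s [i j]] [s' [i' j']] [-> -> ->].
  rewrite -(card_imset _ inj); apply: eq_card => -[[s i] j]; rewrite !inE /=.
  apply/idP/imsetP => [H|[[s' [i' j']] + [-> -> ->]]]; last by rewrite inE.
  by exists (s, (i, j)); rewrite ?inE.
pose J s := [set ij : 'I_n * 'I_n | switch s u v ij.1 ij.2 \notin X].
have -> : #|E| = #|[set t : lift * ('I_n * 'I_n) | (t.1 \in X) && (t.2 \in J t.1)]|.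
  by apply: eq_card => t; rewrite !inE.
apply: card_dep_le => s sX.
have [B [cB HB]] := X_robust sX.
pose Bu := [set i | (u, i) \in B]; pose Bv := [set j | (v, j) \in B].
have cBw w : #|[set i : 'I_n | (w, i) \in B]| <= beta.
  apply: leq_trans cB; rewrite -(card_imset _ (f := fun i => (w, i))); last by move=> ? ? [].
  by apply/subset_leq_card/subsetP => _ /imsetP[i + ->]; rewrite inE.
apply: (@leq_trans #|finset.setX Bu setT :|: finset.setX setT Bv|).
  apply/subset_leq_card/subsetP => -[i j]; rewrite !inE /= andbT => /negP H.
  by apply: contraT; rewrite negb_or => /andP[ui vj]; case: H; apply: HB.
apply: leq_trans (leq_card_setU _ _) _; rewrite !cardsX cardsT card_ord.
by have := cBw u; have := cBw v; rewrite -/Bu -/Bv; nia.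
Qed.

Definition penult (p : seq V) b := nth b (rev p) 1.

(* The tuples (s, a, b) that remain to be joined, a in the fiber [w] and b in the fiber [z]:
   the next switch uses the edge [{w, w1}] and the last one the edge [{ws, z}], so the first and
   the last step of the path must not. *)
Definition end_pair z ws g Q h w w1 : {set lift * 'I_n * 'I_n} :=
  [set t : lift * 'I_n * 'I_n | `[< t.1.1 \notin X /\ exists p,
    [/\ path_cover c1 t.1.1 c Q ((w, t.1.2) :: p),
        last (w, t.1.2) p = (z, t.2),
        (head (w, t.1.2) p).1 != w1 /\ (penult ((w, t.1.2) :: p) (z, t.2)).1 != ws,
        linked t.1.1 c ((w, t.1.2) :: p) &
        forall u, h <= turns g u ((w, t.1.2) :: p)] >] ].

Lemma end_no_exit s a p d Q : s \notin X -> Q <= Qmax -> path_cover c1 s c Q (a :: p) ->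
  lift_adj s a d -> d \in a :: p.
Proof.
move=> sX QQ H ad; apply: contraNT sX => dp.
by apply: X_swallow ad dp; apply: path_cover_mono H.
Qed.

(* The only path steps that a switch at the endpoint [(w, i)] can destroy are its
   first step and the steps at [x]. *)
Lemma end_keep s w w1 i j c' Q p : h2 w w1 -> path_cover c1 s c' Q ((w, i) :: p) ->
  (head (w, i) p).1 != w1 ->
  (forall y, (y, (w1, j)) \in steps ((w, i) :: p) -> y.1 = w -> False) ->
  (forall y, ((w1, j), y) \in steps ((w, i) :: p) -> y.1 = w -> False) ->
  path_cover c1 (switch s w w1 i j) c' Q ((w, i) :: p).
Proof.
move=> ww1 H hd N1 N2; have [Up _ _ _ _] := H.
apply: (path_cover_switch ham1 ham2 disj ww1 H) => x y xy; split.
- apply/negP => /and3P[/eqP xw /eqP yw1 /orP[]/eqP E].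
    case: p hd Up xy {H N1 N2} => [|b p] // /negP bw1 Up xy; case: bw1.
    have : ((w, i), b) \in steps ((w, i) :: b :: p) by rewrite /= inE eqxx.
    by rewrite E in xy => /(steps_inj1 Up xy) <-; apply/eqP.
  by move: xy; rewrite E => /N1; apply.
- apply/negP => /and3P[/eqP xw /eqP yw1 /orP[]/eqP E].
    by have := steps_index Up xy; rewrite E /= eqxx.
  by move: xy; rewrite E => /N2; apply.
Qed.

Lemma steps_penult p y b : uniq p -> (y, b) \in steps p -> last y p = b -> penult p b = y.
Proof.
move=> Up /mem_stepsP[p1 [p2 E]]; rewrite /penult; move: Up; rewrite {p}E last_cat /=.
case/lastP: p2 => [|p2 d]; first by rewrite rev_cat.
by rewrite last_rcons => + E; rewrite {d}E cat_uniq 2!cons_uniq mem_rcons mem_head /= !andbF.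
Qed.

Lemma penult_cat p1 p1' x p2 b : p2 <> [::] -> penult (p1 ++ x :: p2) b = penult (p1' ++ x :: p2) b.
Proof.
case/lastP: p2 => // p2 d _; rewrite /penult !rev_cat !rev_cons !rev_rcons /=.
by rewrite !nth_cat size_rcons.
Qed.

Lemma steps_last a p y : uniq (a :: p) -> (last a p, y) \in steps (a :: p) -> False.
Proof.
move=> Up /[dup] H /(steps_index Up) E; have /andP[_] := steps_mem H.
by rewrite -index_mem E index_last //= ltnn.
Qed.

Lemma exit_keep s u v i j p x d : h2 u v -> (u, i) \in p -> (v, j) \in p ->
  d \notin p -> x != (u, i) -> x != (v, j) -> lift_adj s x d ->
  lift_adj (switch s u v i j) x d.
Proof.
move=> uv up vp dp xu xv; move/switch_keep; apply; first exact: (h2_adj ham2).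
  by rewrite (negbTE xu); apply/negP => /and3P[_ _ /eqP E]; rewrite E vp in dp.
by rewrite (negbTE xv) orbF; apply/negP => /and3P[_ _ /eqP E]; rewrite E up in dp.
Qed.

(** The switch that joins the two ends over the edge of [ws] and [z] enters [X] by [X_close]. Its
    inverse is a switch leaving [X] which determines the tuple, so [card_leave] applies. *)
Lemma card_end_close z ws g Q h : h2 ws z -> Q <= Qmax ->
  #|end_pair z ws g Q h ws z| <= #|X| * (2 * beta * n).
Proof.
move=> wz QQ; have aw := h2_adj ham2 wz; apply: leq_trans (card_leave wz).
pose f (t : lift * 'I_n * 'I_n) :=
  (switch t.1.1 ws z t.1.2 t.2, t.1.2, fiber_perm t.1.1 ws z t.1.2).
have finj : injective f.
  move=> [[s i] l] [[s' i'] l'] [E1 E2 E3]; subst i'.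
  have El : l = l' by rewrite -(switchE s i l aw) E1 switchE.
  by subst l'; rewrite -(switchK s i l aw) E1 E3 switchK.
rewrite -[leqLHS](card_imset _ finj); apply/subset_leq_card/subsetP => _ /imsetP[[[s i] l] + ->].
rewrite !inE /= => /asboolP /= [sX [p [H Hl [hd pn] lk _]]].
rewrite switchK // sX andbT; have [Up _ _ _ _] := H.
have lp : (z, l) \in (ws, i) :: p by rewrite -Hl mem_last.
have H' : path_cover c1 (switch s ws z i l) c Q ((ws, i) :: p).
  apply: end_keep => // y ys yw.
    by move: pn; rewrite (steps_penult Up ys) ?Hl // yw eqxx.
  by move: ys; rewrite -Hl => /steps_last; apply.
apply: (X_close (path_cover_mono (leqnn _) QQ H')).
  by rewrite Hl lift_adj_sym switch_lift_adj.
case: lk => [->|[x [d [xp dp xd]]]]; [by left | right; exists x, d; split=> //].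
apply: (exit_keep (p := (ws, i) :: p)) => //; rewrite ?mem_head //.
  by apply: contraNneq dp => E; rewrite E in xd; apply: (end_no_exit sX QQ H).
apply: contraNneq dp => E; rewrite E -Hl in xd.
have := path_cover_rev ham1 H; rewrite lastI rev_rcons => /(end_no_exit sX QQ)/(_ xd).
by rewrite -rev_rcons -lastI mem_rev.
Qed.

Lemma fiber_perm_switch_h1 s u v i j w w' : h2 u v -> h1 w w' ->
  fiber_perm (switch s u v i j) w w' = fiber_perm s w w'.
Proof.
move=> uv ww'; rewrite /switch fiber_perm_twist_neq //; apply: contraTneq ww' => -[-> ->].
  by rewrite (h2_h1 disj uv).
by rewrite (ham_edge_sym _ _ ham1) (h2_h1 disj uv).
Qed.

Definition moves z ws g Q h w w1 w2 (t : lift * 'I_n * 'I_n) : {set 'I_n} :=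
  [set j | (switch t.1.1 w w1 t.1.2 j \in X) ||
    ((switch t.1.1 w w1 t.1.2 j, fiber_perm t.1.1 w1 (g w1) j, t.2)
       \in end_pair z ws g Q h (g w1) w2)].

(** The pivots over [w1] with [h' + #|G| * Q.+1] turns ahead are used: [turns_comparable] converts
    this reserve into [h'] turns over every fiber. At most [4 * Q + 3] of them have to be
    discarded. *)
Lemma card_moves z ws g Q h h' w w1 w2 t : orientation c1 g -> h2 w w1 -> h2 (g w1) w2 ->
  Q < Qmax -> t \in end_pair z ws g Q h w w1 ->
  h - (h' + #|G| * Q.+1) - (4 * Q + 3) <= #|moves z ws g Q.+1 h' w w1 w2 t|.
Proof.
move=> og ww1 gw2 QQ; case: t => -[s i] l; rewrite inE /= => /asboolP /= [sX [p [H Hl [hd pn]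
  lk Ht]]].
have [Up Sp _ _ Qp] := H; have [_ gE _ _] := og.
have h1g : h1 w1 (g w1) by rewrite gE eqxx.
pose P := (w, i) :: p; rewrite -/P in Up Sp Qp Ht lk pn H.
have [A [cA HA]] := pivots g w1 (h' + #|G| * Q.+1) Up.
pose Y x : V := (g w1, fiber_perm s w1 (g w1) x.2).
(* The exit edge at [c0] has to survive the switch; for [c = 0] any vertex serves. *)
have [c0 Hc0] : exists c0, c = 0 \/ exists d, [/\ c0 \in P, d \notin P & lift_adj s c0 d].
  by case: lk => [->|[x [d xd]]]; [exists (w, i); left | exists x; right; exists d].
(* A pivot in [B1] lies on a costly step, which the switch might break, or is the fixed end or the
   exit vertex. For a pivot in [B2] the new end lies on a costly step or is the old end; outside
   [B2] the new first step runs over the first cycle and so avoids the next switch edge. *)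
pose B1 := touched c1 P :|: [set (z, l); c0].
pose B2 := [set x in A | Y x \in touched c1 P :|: [set (w, i)]].
have Qt : #|touched c1 P| <= 2 * Q.
  by apply: leq_trans (card_touched c1 P) _; rewrite leq_mul2l Qp.
have A1 x : x \in A -> x.1 = w1 by case/HA => p1 [y [p2 []]].
have cB1 : #|B1| <= 2 * Q + 2.
  apply: leq_trans (leq_card_setU _ _) _; apply: leq_add Qt _.
  by rewrite cards2; case: (_ != _).
have cB2 : #|B2| <= 2 * Q + 1.
  have inj : {in B2 &, injective Y}.
    move=> [x1 x2] [y1 y2]; rewrite !inE => /andP[/A1 /= -> _] /andP[/A1 /= -> _].
    by move=> [] /perm_inj ->.
  rewrite -(card_in_imset inj); apply: (@leq_trans #|touched c1 P :|: [set (w, i)]|).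
    by apply/subset_leq_card/subsetP => _ /imsetP[x + ->]; rewrite [x \in B2]inE => /andP[].
  by apply: leq_trans (leq_card_setU _ _) _; rewrite cards1 leq_add2r.
have cA' : h - (h' + #|G| * Q.+1) - (4 * Q + 3) <= #|A :\: (B1 :|: B2)|.
  have arith (nA nI nD nB b1 b2 t r : nat) : t - r <= nA -> h <= t -> nI + nD = nA ->
      nI <= nB -> nB <= b1 + b2 -> b1 <= 2 * Q + 2 -> b2 <= 2 * Q + 1 ->
      h - r - (4 * Q + 3) <= nD.
    by clear; lia.
  apply: arith cA (Ht w1) (cardsID (B1 :|: B2) A) _ (leq_card_setU B1 B2) cB1 cB2.
  exact: subset_leq_card (subsetIr A (B1 :|: B2)).
apply: leq_trans cA' _; have inj2 : {in A :\: (B1 :|: B2) &, injective snd}.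
  move=> [x1 x2] [y1 y2]; rewrite !in_setD => /andP[_ /A1 /= ->] /andP[_ /A1 /= ->].
  by move=> /= ->.
rewrite -(card_in_imset inj2); apply/subset_leq_card/subsetP => _ /imsetP[x + ->].
rewrite in_setD in_setU negb_or => /andP[/andP[xB1 xB2] xA].
have [p1 [y [p2 [E yg xw1 hx]]]] := HA _ xA.
move: xB1; rewrite /B1 in_setU in_set2 !negb_or => /and3P[xt xl xc0].
have xE : x = (w1, x.2) by rewrite -xw1 -surjective_pairing.
have yx : (y, x) \in steps P by rewrite E steps_cat mem_cat inE eqxx orbT.
have adjyx : lift_adj s y x by move: Sp; rewrite sorted_steps => /allP/(_ _ yx).
have yE : y = Y x.
  move: adjyx; rewrite lift_adj_sym lift_adjE xw1 yg => /andP[_ /eqP y2].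
  by rewrite /Y y2 -yg -surjective_pairing.
have : ~~ ((y \in touched c1 P) || (y == (w, i))).
  by move: xB2; rewrite inE xA -yE /= in_setU in_set1.
rewrite negb_or => /andP[yt yh]; rewrite in_set; apply/orP.
case: (boolP (switch _ _ _ _ _ \in X)) => [_|s'X]; [by left | right].
have keep : path_cover c1 (switch s w w1 i x.2) c Q P.
  apply: end_keep => // y'; rewrite -xE => /(touchedP c1) [hh|/andP[y't xt']] y'w.
  - by move: hh; rewrite y'w xw1 (h2_h1 disj ww1).
  - by rewrite xt' in xt.
  - by move: hh; rewrite y'w xw1 (ham_edge_sym _ _ ham1) (h2_h1 disj ww1).
  - by rewrite y't in xt.
case: p1 E => [|b q1] E; first by move: E yh => [<-]; rewrite eqxx.
case: E => Eb Ep; subst b.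
have ax : lift_adj (switch s w w1 i x.2) (w, i) x.
  by rewrite {2}xE switch_lift_adj // (h2_adj ham2).
have new : path_cover c1 (switch s w w1 i x.2) c Q.+1 (y :: rev ((w, i) :: q1) ++ x :: p2).
  have := keep; rewrite /P Ep => keep'; have := path_cover_rot ham1 keep' ax.
  by rewrite -rcons_cons rev_rcons.
rewrite in_set; apply/asboolP => /=; split=> //; exists (rev ((w, i) :: q1) ++ x :: p2).
have Ey : (g w1, fiber_perm s w1 (g w1) x.2) = y by rewrite yE.
have Pp : y :: rev ((w, i) :: q1) ++ x :: p2 =i P.
  move=> v; rewrite /P Ep !(inE, mem_cat, mem_rev, mem_rcons); by do !case: (_ == _) => //=;
    case: (_ \in _).
have lP : last (w, i) p = last x p2 by rewrite Ep last_cat.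
have p2n0 : p2 <> [::] by move=> E0; move: lP xl; rewrite E0 Hl /= => <-; rewrite eqxx.
have QQ' := ltnW QQ.
rewrite Ey; split=> //.
- by rewrite last_cat /= -lP.
- split.
    rewrite lastI rev_rcons /=.
    have y'y : (last (w, i) q1, y) \in steps P.
      by rewrite /P Ep -cats1 -catA steps_cat_cons mem_cat inE eqxx orbT.
    case: (touchedP c1 y'y) => [hh|/andP[_]]; last by rewrite (negbTE yt).
    apply: contraTneq hh => ->; rewrite yg.
    by rewrite (ham_edge_sym _ _ ham1) (h2_h1 disj gw2).
  move: pn; rewrite /P Ep -[y :: _ ++ _]cat_cons -[(w, i) :: _ ++ _]cat_cons.
  by rewrite (@penult_cat (y :: rev ((w, i) :: q1)) ((w, i) :: rcons q1 y) x p2 (z, l) p2n0).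
- case: Hc0 => [->|[d [c0P dP c0d]]]; [by left | right; exists c0, d].
  rewrite !Pp; split=> //; have xP : x \in P by case/andP: (steps_mem yx).
  apply: (exit_keep (p := P)) => //; rewrite -?xE ?mem_head //; last by rewrite eq_sym.
  by apply: contraNneq dP => E; rewrite E in c0d; apply: (end_no_exit sX QQ' H).
(* The rotation does not change the path from the pivot [x] on, so the turns reserved there
   remain. *)
move=> u; rewrite -cat_cons; apply: leq_trans (turns_suffix g u _ x p2).
have [Un Sn _ _ _] := new; rewrite -cat_cons in Un Sn.
have Ux : uniq (x :: p2) by move: Un; rewrite cat_uniq => /and3P[].
have Sx : sorted (lift_adj (switch s w w1 i x.2)) (x :: p2).
  by move: Sn; rewrite !sorted_steps steps_cat_cons all_cat /= => /and3P[].
have := turns_comparable u w1 og Ux Sx; move: hx.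
have : cost c1 (x :: p2) <= cost c1 P.
  by rewrite /P Ep -cat_cons -rcons_cons cost_cat_rcons addnA leq_addl.
move=> c_le hx' cmp; rewrite -(leq_add2r (#|G| * (cost c1 (x :: p2)).+1)).
apply: leq_trans cmp; apply: leq_trans hx'.
by rewrite leq_add2l leq_mul2l ltnS (leq_trans c_le Qp) orbT.
Qed.

Lemma end_pair_notin z ws g Q h w w1 t : t \in end_pair z ws g Q h w w1 -> t.1.1 \notin X.
Proof. by rewrite inE => /asboolP[]. Qed.

(* The inverse of a switch is a switch, so entering [X] is counted by [card_leave]. *)
Lemma card_enter w w1 (A : {set lift * 'I_n * 'I_n}) : h2 w w1 ->
  (forall t, t \in A -> t.1.1 \notin X) ->
  #|[set tj : lift * 'I_n * 'I_n * 'I_n |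
      (tj.1 \in A) && (switch tj.1.1.1 w w1 tj.1.1.2 tj.2 \in X)]|
    <= #|X| * (2 * beta * n) * n.
Proof.
move=> ww1 HA; have aw := h2_adj ham2 ww1.
pose f (tj : lift * 'I_n * 'I_n * 'I_n) :=
  ((switch tj.1.1.1 w w1 tj.1.1.2 tj.2, tj.1.1.2, fiber_perm tj.1.1.1 w w1 tj.1.1.2), tj.1.2).
have finj : injective f.
  move=> [[[s i] l] j] [[[s' i'] l'] j'] [E1 E2 E3 E4]; subst i' l'.
  have Ej : j = j' by rewrite -(switchE s i j aw) E1 switchE.
  by subst j'; rewrite -(switchK s i j aw) E1 E3 switchK.
have := leq_mul (card_leave ww1) (leqnn n); set L := [set t | _] => lL.
apply: leq_trans (_ : #|finset.setX L [set: 'I_n]| <= _); last by rewrite cardsX cardsT card_ord.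
rewrite -[leqLHS](card_imset _ finj); apply/subset_leq_card/subsetP => _ /imsetP[[[[s i] l] j]
  + ->].
by rewrite !inE /= andbT switchK // => /andP[/HA /= -> ->].
Qed.

(** Each tuple has at least [n / C] moves. A move to a new tuple is determined by that tuple and the
    old partner of the first end, one of [n] values; the moves into [X] are bounded by
    [card_enter]. *)
Lemma card_end_step z ws g Q h h' w w1 w2 C : orientation c1 g -> h2 w w1 ->
  h2 (g w1) w2 -> Q < Qmax -> 0 < n ->
  n <= C * (h - (h' + #|G| * Q.+1) - (4 * Q + 3)) ->
  #|end_pair z ws g Q h w w1| <=
    C * (#|end_pair z ws g Q.+1 h' (g w1) w2| + #|X| * (2 * beta * n)).
Proof.
move=> og ww1 gw2 QQ n0; set P := (h - _ - _) => nCP; have aw := h2_adj ham2 ww1.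
have [_ gE _ _] := og; have h1g : h1 w1 (g w1) by rewrite gE eqxx.
set A := end_pair z ws g Q h w w1; set A' := end_pair _ _ _ _ _ _ _.
have AX t : t \in A -> t.1.1 \notin X by apply: end_pair_notin.
have lo := card_dep_ge (fun t H => card_moves h' og ww1 gw2 QQ H) : #|A| * P <= _.
pose E1 := [set tj : lift * 'I_n * 'I_n * 'I_n |
      (tj.1 \in A) && (switch tj.1.1.1 w w1 tj.1.1.2 tj.2 \in X)].
pose E2 := [set tj : lift * 'I_n * 'I_n * 'I_n | (tj.1 \in A) &&
  ((switch tj.1.1.1 w w1 tj.1.1.2 tj.2, fiber_perm tj.1.1.1 w1 (g w1) tj.2, tj.1.2) \in A')].
have cE2 : #|E2| <= #|A'| * n.
  pose f (tj : lift * 'I_n * 'I_n * 'I_n) :=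
    ((switch tj.1.1.1 w w1 tj.1.1.2 tj.2, fiber_perm tj.1.1.1 w1 (g w1) tj.2, tj.1.2),
     fiber_perm tj.1.1.1 w w1 tj.1.1.2).
  have finj : injective f.
    move=> [[[s i] l] j] [[[s' i'] l'] j'] [E1' E2' E3 E4]; subst l'.
    (* The switch preserves the matchings over the first cycle, so the new end determines [j]. *)
    have Ej : j = j'.
      apply: (@perm_inj _ (fiber_perm s w1 (g w1))); rewrite E2'.
      by rewrite -(fiber_perm_switch_h1 s i j ww1 h1g) E1' fiber_perm_switch_h1.
    subst j'; have Ei : i = i'.
      apply: (@perm_inj _ (fiber_perm (switch s w w1 i j) w w1)).
      by rewrite switchE // E1' switchE.
    by subst i'; rewrite -(switchK s i j aw) E1' E4 switchK.
  apply: leq_trans (_ : #|finset.setX A' [set: 'I_n]| <= _); last by rewrite cardsX cardsT card_ord.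
  rewrite -[leqLHS](card_imset _ finj).
  by apply/subset_leq_card/subsetP => _ /imsetP[tj + ->]; rewrite !inE andbT => /andP[].
have up : #|A| * P <= (#|A'| + #|X| * (2 * beta * n)) * n.
  apply: leq_trans lo _; rewrite mulnDl.
  apply: leq_trans (_ : _ <= #|E2| + #|E1|) _; last first.
    by apply: leq_add cE2 _; apply: card_enter.
  apply: leq_trans (leq_card_setU _ _); apply/subset_leq_card/subsetP => tj.
  rewrite in_set => /andP[tA]; rewrite [_ \in moves _ _ _ _ _ _ _ _ _]in_set in_setU orbC.
  by case/orP => H; apply/orP; [left|right]; rewrite in_set; apply/andP.
rewrite -(leq_pmul2r n0); apply: leq_trans (leq_mul (leqnn _) nCP) _.
by rewrite mulnCA -mulnA leq_mul2l up orbT.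
Qed.

(* A walk of alternating steps: along an edge of the second cycle, then along the
   orientation [g] of the first one. *)
Inductive walk (g : G -> G) (ws z : G) : nat -> G -> G -> Prop :=
| Walk0 of h2 ws z : walk g ws z 0 ws z
| WalkS m w w1 w2 of h2 w w1 & walk g ws z m (g w1) w2 : walk g ws z m.+1 w w1.

Lemma walk_edge g ws z m w w1 : walk g ws z m w w1 -> h2 w w1.
Proof. by case. Qed.

(** Each move consumes [H] turns of the reserve [m * H] and one unit of cost. Going back from
    [card_end_close], a move multiplies by [C] the sum of the previous bound and the bound for
    switches entering [X], hence the factor [2 * C]. *)
Lemma card_end_walk g ws z m w w1 H C Q : orientation c1 g -> walk g ws z m w w1 ->
  0 < n -> 0 < C -> n <= C * (H - #|G| * Qmax.+1 - (4 * Qmax + 3)) -> Q + m <= Qmax ->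
  #|end_pair z ws g Q (m * H) w w1| <= (2 * C) ^ m * (#|X| * (2 * beta * n)).
Proof.
move=> og W n0 C0 nC; elim: W Q => [wz|{}m {}w {}w1 w2 ww1 W IH] Q QQ.
  by rewrite expn0 mul1n; apply: card_end_close => //; rewrite addn0 in QQ.
have QQ' : Q < Qmax by apply: leq_trans QQ; rewrite addnS ltnS leq_addr.
have num : n <= C * (m.+1 * H - (m * H + #|G| * Q.+1) - (4 * Q + 3)).
  apply: leq_trans nC _; rewrite leq_mul2l; apply/orP; right; rewrite (mulSn m H).
  rewrite [H + _]addnC subnDl; apply: leq_sub; last by rewrite leq_add2r leq_mul2l (ltnW QQ') orbT.
  by rewrite leq_sub2l // leq_mul2l ltnS (ltnW QQ') orbT.
apply: leq_trans (card_end_step z ws og ww1 (walk_edge W) QQ' n0 num) _.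
have := IH Q.+1; rewrite addSn -addnS => /(_ QQ) le1.
move: le1; set L := #|X| * _ => le1.
have -> : (2 * C) ^ m.+1 * L = C * (2 * ((2 * C) ^ m * L)) by rewrite expnS !mulnA [2 * C]mulnC.
rewrite leq_mul2l; apply/orP; right.
apply: leq_trans (leq_add le1 (leqnn _)) _; rewrite (mul2n (_ * L)) -addnn leq_add2l.
by rewrite leq_pmull // expn_gt0 muln_gt0 C0.
Qed.

Definition exits w w1 z Q : {set lift * 'I_n * 'I_n} :=
  [set t : lift * 'I_n * 'I_n | `[< t.1.1 \notin X /\ exists p,
    [/\ path_cover c1 t.1.1 c Q ((w, t.1.2) :: p), last (w, t.1.2) p = (z, t.2),
        (head (w, t.1.2) p).1 != w1 &
        n <= 4 * #|[set j : 'I_n | (w1, j) \notin (w, t.1.2) :: p]|] >] ].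

(** For at least a quarter of all [j] the vertex [(w1, j)] is off the path, and joining the first
    end to it enters [X] by [X_swallow]. *)
Lemma card_exits w w1 z Q : h2 w w1 -> Q <= Qmax -> 0 < n ->
  #|exits w w1 z Q| <= 4 * (#|X| * (2 * beta * n)).
Proof.
move=> ww1 QQ n0; set A := exits _ _ _ _.
have AX t : t \in A -> t.1.1 \notin X by rewrite in_set => /asboolP[].
pose J (t : lift * 'I_n * 'I_n) := [set j | switch t.1.1 w w1 t.1.2 j \in X].
(* This quotient is [n / 4] rounded up. *)
have lo t : t \in A -> (n + 3) %/ 4 <= #|J t|.
  case: t => [[s i] l]; rewrite in_set => /asboolP[/= sX [p [H Hl hd nJ]]].
  suff : #|[set j : 'I_n | (w1, j) \notin (w, i) :: p]| <= #|J (s, i, l)|.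
    by move: nJ; move: #|_| #|_| => a b; clear; lia.
  apply/subset_leq_card/subsetP => j; rewrite [in X in X -> _]in_set => jp; rewrite in_set /=.
  have H' : path_cover c1 (switch s w w1 i j) c Q ((w, i) :: p).
    apply: end_keep => // y => /steps_mem /andP[yp]; first by rewrite (negbTE jp).
    by move=> ? _; rewrite yp in jp.
  apply: (X_swallow (path_cover_mono (leqnn _) QQ H')) jp.
  by rewrite switch_lift_adj // (h2_adj ham2).
have := card_dep_ge lo; set E := [set z0 | _] => cE.
have cE' : #|E| <= #|X| * (2 * beta * n) * n.
  apply: leq_trans (card_enter ww1 AX); apply: subset_leq_card.
  by apply/subsetP => tj; rewrite !in_set => /andP[-> ->].
have := leq_trans cE cE'; move: #|A| (#|X| * _) n0; clear=> a L n0 aL.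
rewrite -(leq_pmul2r n0); have : n <= 4 * ((n + 3) %/ 4) by lia.
by nia.
Qed.

Definition loose_pairs Q : {set lift * V * V} :=
  [set t : lift * V * V | `[< t.1.1 \notin X /\ exists p,
    [/\ path_cover c1 t.1.1 c Q (t.1.2 :: p), last t.1.2 p = t.2 &
        linked t.1.1 c (t.1.2 :: p)] >] ].

Lemma end_pair_le z ws g Q h h' w w1 : h' <= h ->
  end_pair z ws g Q h w w1 \subset end_pair z ws g Q h' w w1.
Proof.
move=> hh; apply/subsetP => t; rewrite !in_set => /asboolP[tX [p [? ? ? ? ht]]].
apply/asboolP; split=> //; exists p; split=> // u; exact: leq_trans hh (ht u).
Qed.

(** Every vertex over [w], except possibly the first of the path, is entered from one of the two
    neighbours of [w] on the first cycle or by a costly step. *)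
Lemma count_fiber_turns w p : count (fun x => x.1 == w) p <=
  (turns (next c1) w p + turns (prev c1) w p + cost c1 p).+1.
Proof.
case: p => // x p; rewrite -addn1 /= addnC leq_add //; last by case: (_ == _).
elim: p x => //= y p IHp x; rewrite /turns /cost /=.
have := IHp y; rewrite /turns /cost /=.
have : (y.1 == w) <= ((x.1 == next c1 w) && (y.1 == w)) +
    ((x.1 == prev c1 w) && (y.1 == w)) + ~~ h1 x.1 y.1.
  case: (boolP (y.1 == w)) => //= /eqP->; rewrite !andbT ham_edge //.
  have U := ham_uniq ham1.
  case: (boolP (x.1 == next c1 w)) => // _; case: (boolP (x.1 == prev c1 w)) => // N.
  rewrite orbF; case: (boolP (w == next c1 x.1)) => // /eqP E.
  by rewrite E prev_next ?eqxx in N.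
by move: (_ && _ : nat) (_ &&
  _ : nat) (~~ _ : nat) (y.1 == w : nat) (count _ _) (count _ _) (count _ _) (count _ _); clear;
    lia.
Qed.

Lemma h2_avoid w v : exists2 w1, h2 w w1 & v != w1.
Proof.
case: (v =P next c2 w) => [->|/eqP N]; last by exists (next c2 w); rewrite // ham_edge ?eqxx.
have U := ham_uniq ham2; exists (prev c2 w).
  by rewrite ham_edge // next_prev // eqxx orbT.
by apply: contraNneq (ham_next2 w ham2) => ->; rewrite next_prev.
Qed.

(** If the path covers more than three quarters of the fiber of [w1], one of the two orientations of
    the first cycle has many turns there, and hence over every fiber. This is the orientation kept
    during the walk. *)
Lemma loose_classify s a b Q h : (s, a, b) \in loose_pairs Q ->
  4 * (2 * (h + #|G| * Q.+1) + Q.+1) <= n ->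
  exists w1 ws, [/\ h2 a.1 w1, h2 ws b.1 &
    [|| (s, a.2, b.2) \in exits a.1 w1 b.1 Q,
        (s, a.2, b.2) \in end_pair b.1 ws (next c1) Q h a.1 w1 |
        (s, a.2, b.2) \in end_pair b.1 ws (prev c1) Q h a.1 w1]].
Proof.
case: a b => [w i] [z l]; rewrite in_set => /asboolP[/= sX [p [H Hl lk]]] hn.
have [w1 ww1 hd] := h2_avoid w (head (w, i) p).1.
have [ws zws pn] := h2_avoid z (penult ((w, i) :: p) (z, l)).1.
exists w1, ws; split=> //; first by rewrite (ham_edge_sym _ _ ham2).
have [Up Sp _ _ Qp] := H.
have end_in g : orientation c1 g -> h + #|G| * Q.+1 <= turns g w1 ((w, i) :: p) ->
    (s, i, l) \in end_pair z ws g Q h w w1.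
  move=> og ht; rewrite in_set; apply/asboolP => /=; split=> //; exists p; split=> // u.
  rewrite -(leq_add2r (#|G| * (cost c1 ((w, i) :: p)).+1)).
  apply: leq_trans (turns_comparable u w1 og Up Sp); apply: leq_trans ht.
  by rewrite leq_add2l leq_mul2l ltnS Qp orbT.
case: (boolP (n <= 4 * #|[set j : 'I_n | (w1, j) \notin (w, i) :: p]|)) => [small|big].
  by apply/orP; left; rewrite in_set; apply/asboolP => /=; split=> //; exists p.
apply/orP; right.
pose J := [set j : 'I_n | (w1, j) \in (w, i) :: p].
have cJ : #|J| <= count (fun x => x.1 == w1) ((w, i) :: p).
  rewrite -size_filter; apply: leq_trans (card_size _).
  have inj : injective (fun j : 'I_n => (w1, j)) by move=> ? ? [].
  rewrite -(card_imset _ inj); apply/subset_leq_card/subsetP => _ /imsetP[j jP ->].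
  by rewrite mem_filter eqxx; move: jP; rewrite in_set.
have cC : #|J| + #|[set j : 'I_n | (w1, j) \notin (w, i) :: p]| = n.
  rewrite -[RHS]card_ord -(cardsC J); congr (_ + _); apply: eq_card => j.
  by rewrite in_setC !in_set.
have := leq_trans cJ (count_fiber_turns w1 _).
case: (leqP (h + #|G| * Q.+1) (turns (next c1) w1 ((w, i) :: p))) => [le1|l1].
  by rewrite (end_in _ (orientation_next ham1) le1).
case: (leqP (h + #|G| * Q.+1) (turns (prev c1) w1 ((w, i) :: p))) => [le2|l2].
  by rewrite (end_in _ (orientation_prev ham1) le2) orbT.
move: l1 l2 cC big Qp hn.
move: (turns _ _ _) (turns _ _ _) (cost _ _) #|J| #|_| (h + #|G| * Q.+1) => t1 t2 co nJ nK hh.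
by clear; lia.
Qed.

(** There are [#|G| ^ 4] choices of [w], [w1], [ws], [z], with three classes of tuples each; since
    [2 <= C], the factor 4 of [card_exits] is absorbed into the power of [2 * C]. *)
Lemma card_loose Q H C (m : G -> G -> G -> G -> (G -> G) -> nat) :
  (forall w w1 ws z g, orientation c1 g -> h2 w w1 -> h2 ws z ->
     m w w1 ws z g <= #|G| /\ walk g ws z (m w w1 ws z g) w w1) ->
  0 < n -> 2 <= C -> n <= C * (H - #|G| * Qmax.+1 - (4 * Qmax + 3)) ->
  Q + #|G| <= Qmax -> 4 * (2 * (#|G| * H + #|G| * Q.+1) + Q.+1) <= n -> 0 < #|G| ->
  #|loose_pairs Q| <= #|G| ^ 4 * (3 * (2 * C) ^ #|G| * (#|X| * (2 * beta * n))).
Proof.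
move=> Hm n0 C2 nC QQ hn G0; set L := #|X| * _.
have C0 : 0 < C by apply: leq_trans C2.
pose K (k : G * G * G * G) : {set lift * 'I_n * 'I_n} :=
  let: (w, w1, ws, z) := k in if h2 w w1 && h2 ws z then
    exits w w1 z Q :|: (end_pair z ws (next c1) Q (#|G| * H) w w1 :|:
                       end_pair z ws (prev c1) Q (#|G| * H) w w1) else set0.
have cE g w w1 ws z : orientation c1 g -> h2 w w1 -> h2 ws z ->
    #|end_pair z ws g Q (#|G| * H) w w1| <= (2 * C) ^ #|G| * L.
  move=> og ww1 wsz; have [mG W] := Hm _ _ _ _ _ og ww1 wsz.
  have := card_end_walk og W n0 C0 nC (leq_trans (_ : Q + m w w1 ws z g <= Q + #|G|) QQ).
  rewrite leq_add2l => /(_ mG) le1.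
  apply: leq_trans (subset_leq_card (end_pair_le _ _ _ _ _ _ (_ : m w w1 ws z g * H <=
    #|G| * H))) _.
    by rewrite leq_mul2r mG orbT.
  apply: leq_trans le1 _; rewrite leq_mul2r leq_pexp2l ?orbT //.
  by rewrite muln_gt0 C0.
have cX w w1 z : h2 w w1 -> #|exits w w1 z Q| <= (2 * C) ^ #|G| * L.
  move=> ww1; apply: leq_trans (card_exits z ww1 _ n0) _.
    by apply: leq_trans QQ; apply: leq_addr.
  rewrite leq_mul2r; apply/orP; right.
  apply: leq_trans (_ : (2 * C) ^ 1 <= _); first by rewrite expn1 (leq_mul2l 2 2 C).
  by rewrite leq_pexp2l // muln_gt0 C0.
have cK k : #|K k| <= 3 * (2 * C) ^ #|G| * L.
  case: k => [[[w w1] ws] z] /=; case: ifP => [/andP[ww1 wsz]|_]; last by rewrite cards0.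
  apply: leq_trans (leq_card_setU _ _) _; rewrite -mulnA mulSn leq_add ?cX //.
  apply: leq_trans (leq_card_setU _ _) _; rewrite mulSn mul1n leq_add ?cE //.
    exact: orientation_next.
  exact: orientation_prev.
have : #|G| ^ 4 * (3 * (2 * C) ^ #|G| * L) =
    #|[set: G * G * G * G]| * (3 * (2 * C) ^ #|G| * L).
  by rewrite cardsT !card_prod !expnS expn0 muln1 !mulnA.
move=> ->; apply: leq_trans (card_dep_le (fun k _ => cK k)).
set S := [set z | _]; pose f (x : G * G * G * G * (lift * 'I_n * 'I_n)) : lift * V * V :=
  (x.2.1.1, (x.1.1.1.1, x.2.1.2), (x.1.2, x.2.2)).
apply: leq_trans (leq_imset_card f S); apply/subset_leq_card/subsetP => -[[s a] b] H0.
have [w1 [ws [ww1 wsz]]] := loose_classify H0 hn.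
rewrite -!in_setU => HK; apply/imsetP; exists ((a.1, w1, ws, b.1), (s, a.2, b.2)).
  by rewrite in_set /= in_setT ww1 wsz.
by rewrite /f /= -!surjective_pairing.
Qed.

End Transfer.

(** * Alternating walks in the base graph *)

Section WalkExists.
Variables (G : sgraph) (c1 c2 : seq G).
Hypothesis ham2 : hamilton_cycle c2.
Hypothesis nonbip : ~ bipartite (relU (cycle_edge c1) (cycle_edge c2)).
Implicit Types (u v w : G).

Lemma next_closed (A : {set G}) u v : (forall x, x \in A -> next c2 x \in A) ->
  u \in A -> v \in A.
Proof.
move=> cl uA; rewrite -(iter_findex (ham_connect u v ham2)).
by elim: (findex _ _ _) => //= k; apply: cl.
Qed.

Definition walk_rel (g : G -> G) u v := [exists u1, cycle_edge c2 u u1 && (v == g u1)].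

(* The set [A] of fibers reachable from [u] satisfies [g (N_2 A) \subset A], so counting
   forces [next c2 @: A = prev c2 @: A]; unless [A] is everything, it is then one
   side of a bipartition of both cycles. *)
Lemma walk_rel_connect g u v : orientation c1 g -> connect (walk_rel g) u v.
Proof.
move=> [ginj gE _ _]; pose A := [set x | connect (walk_rel g) u x].
have U := ham_uniq ham2; have pn := prev_next U; have np := next_prev U.
have ninj := can_inj pn; have pinj := can_inj np.
have cl x x1 : x \in A -> cycle_edge c2 x x1 -> g x1 \in A.
  rewrite !inE => ux xx1; apply: connect_trans ux (connect1 _).
  by apply/existsP; exists x1; rewrite xx1 eqxx.
have uA : u \in A by rewrite inE connect0.
have gN (f : G -> G) : injective f -> (forall x, cycle_edge c2 x (f x)) -> g @: (f @: A) = A.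
  move=> finj fE; apply/eqP; rewrite eqEcard !card_imset // leqnn andbT.
  by apply/subsetP => _ /imsetP[_ /imsetP[x xA ->] ->]; apply: cl xA (fE x).
have gnx : g @: (next c2 @: A) = A by apply: gN => // x; rewrite ham_edge // eqxx.
have gpr : g @: (prev c2 @: A) = A by apply: gN => // x; rewrite ham_edge // np eqxx orbT.
pose B := next c2 @: A; have EB : prev c2 @: A = B by apply: (imset_inj ginj); rewrite gnx gpr.
have nA x : (next c2 x \in B) = (x \in A) by rewrite mem_imset.
have nB x : (next c2 x \in A) = (x \in B).
  by rewrite -EB -{2}[x]pn mem_imset.
have gB x : (g x \in A) = (x \in B) by rewrite -gnx mem_imset.
case: (boolP (v \in A)) => [|vA]; first by rewrite inE.
case: nonbip; exists (fun x => x \in A).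
have AUB x : x \in A :|: B.
  apply: (@next_closed (A :|: B) u) => [y|]; last by rewrite in_setU uA.
  by rewrite !in_setU nA nB orbC.
have AIB x : x \in A :&: B -> False.
  move=> xI; have : v \in A :&: B; last by rewrite in_setI (negbTE vA).
  by apply: (@next_closed (A :&: B) x) => // y; rewrite !in_setI nA nB andbC.
have AB x : (x \in B) = (x \notin A).
  have := AUB x; have := AIB x; rewrite in_setI in_setU.
  by case: (x \in A); case: (x \in B) => // /(_ isT).
move=> x y /orP[]; last first.
  by rewrite ham_edge // => /orP[]/eqP->; rewrite nB AB; case: (_ \in _).
by rewrite gE => /orP[]/eqP->; rewrite gB AB; case: (_ \in _).
Qed.

(** The first step to [g w1] is forced; the rest is a path of [walk_rel] from [g w1] to [ws], which,
    once shortened to a simple one, has fewer than [#|G|] steps. *)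
Lemma walk_exists g w w1 ws z : orientation c1 g -> cycle_edge c2 w w1 -> cycle_edge c2 ws z ->
  exists2 m, m <= #|G| & walk c2 g ws z m w w1.
Proof.
move=> og ww1 wsz; have /connectP[p0 P0 L0] := walk_rel_connect (g w1) ws og.
case/shortenP: P0 L0 => p P U _ L; exists (size p).+1.
  by have := max_card (mem (g w1 :: p)); rewrite (card_uniqP U).
elim: p w w1 ww1 P L {U} => [|v p IH] w w1 ww1 /= P L.
  by apply: (WalkS (w2 := z)) ww1 _; rewrite -L; apply: Walk0.
case/andP: P => /existsP[u1 /andP[wu1 /eqP Ev]] P; apply: (WalkS (w2 := u1)) ww1 _.
by apply: IH; rewrite -?Ev.
Qed.

End WalkExists.

(** * The chain of target sets *)

Section Targets.
Variables (G : sgraph) (n : nat) (c1 c2 : seq G).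
Hypotheses (ham1 : hamilton_cycle c1) (ham2 : hamilton_cycle c2).
Hypothesis disj : edge_disjoint c1 c2.
Hypothesis nonbip : ~ bipartite (relU (cycle_edge c1) (cycle_edge c2)).
Local Notation V := (G * 'I_n)%type.
Local Notation lift := {ffun edge G -> 'S_n}.
Implicit Types (s : lift) (x y a b d : V) (p : seq V).

Definition expanding M s := forall A : {set V}, 0 < #|A| <= M ->
  9 * #|A| <= 4 * #|nbhd (lift_adj s) A :\: A|.

Definition lift_connected s := forall U : {set V}, U != finset.set0 -> U != finset.setT ->
  exists x d, [/\ x \in U, d \notin U & lift_adj s x d].

Variables (K m D M : nat).
Hypothesis HK : D + D + #|G| + 2 <= K.

(* [target j.+1]: a path and at most [j] lifted cycles cover all vertices; each cycle
   absorbed so far has paid for [K] steps outside the lift of the first cycle. *)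
Definition target j : {set lift} := if j is j'.+1
  then [set s | `[< exists c a p, [/\ c <= j', c <= m & path_cover c1 s c (K * (m - c)) (a :: p)]
    >]]
  else [set s | `[< exists a p, path_cover c1 s 0 (K * m.+1) (a :: p) /\
                                lift_adj s (last a p) a >]].

Lemma target0 s : s \in target 0 -> hamiltonian (lift_graph s).
Proof. by rewrite inE => /asboolP[a [p [H ap]]]; apply: path_cover_hamiltonian H ap. Qed.

(** The exceptional set consists of the touched vertices and, for [j = 0], the two ends, whose
    adjacency is part of the target. *)
Lemma target_robust j s : s \in target j -> exists B : {set V}, #|B| <= 2 * (K * m.+1) + 2 /\
  forall u v i k, cycle_edge c2 u v -> (u, i) \notin B -> (v, k) \notin B ->
  switch s u v i k \in target j.
Proof.
have card_t p c q : path_cover c1 s c q p -> q <= K * m.+1 -> #|touched c1 p| <= 2 * (K * m.+1).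
  case=> _ _ _ _ Qp qq; apply: leq_trans (card_touched _ _) _.
  by rewrite leq_mul2l (leq_trans Qp qq).
case: j => [|j]; rewrite in_set => /asboolP.
  case=> a [p [H ap]]; exists (touched c1 (a :: p) :|: [set a; last a p]); split.
    apply: leq_trans (leq_card_setU _ _) _; apply: leq_add (card_t _ _ _ H (leqnn _)) _.
    by rewrite cards2; case: (_ != _).
  move=> u v i k uv; rewrite !in_setU !in_set1 !negb_or => /and3P[ut ua ul] /and3P[vt va vl].
  rewrite in_set; apply/asboolP; exists a, p; split.
    exact: (path_cover_touched ham1 ham2 disj uv H ut vt).
  apply: (switch_keep (h2_adj ham2 uv) ap); rewrite ![_ == (_, _)]eq_sym.
    by rewrite (negbTE ul) (negbTE va) !andbF.
  by rewrite (negbTE ua) (negbTE vl) !andbF.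
case=> c [a [p [cj cm H]]]; exists (touched c1 (a :: p)); split.
  apply: leq_trans (card_t _ _ _ H _) (leq_addr _ _).
  by rewrite leq_mul2l (leq_trans (leq_subr _ _) (leqnSn _)) orbT.
move=> u v i k uv ut vt; rewrite in_set; apply/asboolP; exists c, a, p; split;
  [exact: cj | exact: cm |].
exact: (path_cover_touched ham1 ham2 disj uv H ut vt).
Qed.

Variable j : nat.
Hypothesis jm : j <= m.
(** The cost at level [j] increases by [D] rotations at either end and at most [#|G|] moves. By [HK]
    one more [K] covers these and the two steps of [path_cover_merge]. *)
Let Qmax := K * (m - j) + (D + D + #|G|).

Lemma Qmax_le : j = 0 -> Qmax <= K * m.+1.
Proof. by rewrite /Qmax mulnS addnC => ->; rewrite subn0 leq_add2r; apply: leq_trans HK; lia. Qed.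

Lemma Qmax_ltn j' : j = j'.+1 -> Qmax.+2 <= K * (m - j').
Proof.
move=> Ej; have -> : m - j' = (m - j).+1 by lia.
by rewrite mulnS /Qmax addnC -!addSn leq_add2r; apply: leq_trans HK; lia.
Qed.

Lemma target_cover s c q a p j' : j = j'.+1 -> c <= j' -> path_cover c1 s c q (a :: p) ->
  q <= K * (m - j') -> s \in target j.
Proof.
move=> Ej cj H qq; rewrite Ej in_set; apply/asboolP; exists c, a, p; split=> //; first by lia.
apply: path_cover_mono H => //; apply: leq_trans qq _; rewrite leq_mul2l; apply/orP; right; lia.
Qed.

Lemma target_swallow s a p d : path_cover c1 s j Qmax (a :: p) -> lift_adj s a d ->
  d \notin a :: p -> s \in target j.
Proof.
case E: {1}j => [|j'] H ad dp; first by rewrite (path_cover_full ham1 _ H) in dp.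
have [a' [p' H']] := path_cover_swallow ham1 H ad dp.
by apply: (target_cover E _ H') => //; apply: ltnW (Qmax_ltn E).
Qed.

Lemma target_close s a p : path_cover c1 s j Qmax (a :: p) ->
  lift_adj s (last a p) a -> linked s j (a :: p) -> s \in target j.
Proof.
case E: {1 2}j => [|j'] H ap.
  move=> _; rewrite E in_set; apply/asboolP; exists a, p; split=> //.
  by apply: path_cover_mono H => //; apply: Qmax_le.
case=> // -[x [d [xp dp xd]]].
have [a' [p' H']] := path_cover_merge ham1 H ap xp xd dp.
by apply: (target_cover E _ H') => //; apply: Qmax_ltn E.
Qed.

Definition stuck : {set lift} := [set s | [&& s \in target j.+1, s \notin target j &
  `[< expanding M s >] && `[< lift_connected s >] ]].

(** Rotations at the head give [M] ends; for each of them the path is reversed and rotations at the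
    other end give [M] more. As [s] is outside [target j], no end sees a vertex off the path, so
    every neighbour is a pivot. *)
Lemma card_loose_fiber s : 8 ^ D * M < 9 ^ D -> s \in stuck ->
  M * M <= #|[set ab : V * V | (s, ab.1, ab.2) \in
    loose_pairs c1 (target j) j (K * (m - j) + (D + D))]|.
Proof.
move=> HD; rewrite in_set => /and4P[]; rewrite {1}/target in_set.
case/asboolP => c [a0 [p0 [cj cm H0]]] sX /asboolP expM /asboolP conn.
(* With fewer remaining cycles [s] would already lie in [target j]. *)
have Ecj : c = j.
  apply/eqP; rewrite eqn_leq cj leqNgt; apply: contra sX => cltj.
  have Ej : j = j.-1.+1 by lia.
  rewrite Ej in_set; apply/asboolP; exists c, a0, p0; split=> //; lia.
subst c; set Q0 := K * (m - j) in H0 *.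
(* For positive [j], a path through all vertices would place [s] in [target j]; otherwise
   connectivity gives an edge leaving the path. *)
have lk p q a : path_cover c1 s j q (a :: p) -> q <= Q0 + (D + D) -> linked s j (a :: p).
  move=> H qq; case E: {1}j => [|j']; [by left | right].
  have [||x [d []]] := conn [set x in a :: p].
  - by apply/set0Pn; exists a; rewrite in_set mem_head.
  - apply: contraNneq sX => full; have [Up Sp Cp Np Qp] := H.
    apply: (@target_cover s 0 q a p j' E) => //; last first.
      apply: leq_trans qq _; apply: leq_trans (ltnW (ltnW (Qmax_ltn E))).
      by rewrite /Qmax -/Q0 leq_add2l leq_addr.
    split=> //; rewrite leqn0 cards_eq0; apply/eqP/setP => x; rewrite in_set in_set0.
    by have := finset.in_setT x; rewrite -full in_set => ->; rewrite andbF.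
  - by rewrite !in_set => xp dp xd; exists x, d.
have clos p0' q0 a q x : path_cover c1 s j q0 p0' -> q0 + D <= Q0 + (D + D) ->
    reach (lift_adj s) p0' D (a :: q) -> lift_adj s a x -> x \in p0'.
  move=> H qq R ax; rewrite -(perm_mem (reach_perm R)); apply: contraNT sX => xp.
  apply: target_swallow ax xp; apply: path_cover_mono (path_cover_reach ham1 H R) => //.
  by apply: leq_trans qq _; rewrite /Qmax -/Q0 leq_add2l leq_addr.
have big p a q0 : path_cover c1 s j q0 (a :: p) -> q0 + D <= Q0 + (D + D) ->
    M <= #|heads (lift_adj s) (a :: p) D|.
  move=> H qq; have [Up _ _ _ _] := H; apply: ltnW.
  by apply: (heads_large (erefl (a :: p)) Up HD expM) => b q x; apply: clos H qq.
set A := heads (lift_adj s) (a0 :: p0) D.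
have cA : M <= #|A| by apply: big H0 _; rewrite leq_add2l leq_addr.
pose LP a := [set b | (s, b, a) \in loose_pairs c1 (target j) j (Q0 + (D + D))].
have cB a : a \in A -> M <= #|LP a|.
  case/headsP => q R; have H1 := path_cover_reach ham1 H0 R.
  have := path_cover_rev ham1 H1; have := reach_last a R.
  case E: (rev (a :: q)) => [|b0 q'] _ H2; first by have := size_rev (a :: q); rewrite E.
  apply: leq_trans (big _ _ _ H2 _) _; first by rewrite addnA.
  apply/subset_leq_card/subsetP => b /headsP[q2 R2]; rewrite !in_set; apply/asboolP.
  have H3 := path_cover_reach ham1 H2 R2; rewrite -addnA in H3.
  split=> //; exists q2; split; [exact: H3 | | exact: lk H3 (leqnn _)].
  have := reach_last b R2; rewrite /= => ->.
  have -> : last b0 q' = last b0 (b0 :: q') by [].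
  by rewrite -E rev_cons last_rcons.
apply: leq_trans (leq_mul cA (leqnn M)) _; apply: leq_trans (card_dep_ge cB) _.
set S := [set z | _]; pose f (z : V * V) := (z.2, z.1).
have finj : injective f by move=> [? ?] [? ?] [-> ->].
rewrite -(card_imset _ finj); apply/subset_leq_card/subsetP => _ /imsetP[[a b] + ->].
by rewrite [in X in X -> _]in_set /= => /andP[_]; rewrite !in_set.
Qed.

Lemma card_stuck H C : 8 ^ D * M < 9 ^ D -> 0 < n -> 2 <= C ->
  n <= C * (H - #|G| * Qmax.+1 - (4 * Qmax + 3)) ->
  4 * (2 * (#|G| * H + #|G| * Qmax.+1) + Qmax.+1) <= n ->
  #|stuck| * (M * M) <=
    #|G| ^ 4 * (3 * (2 * C) ^ #|G| * (#|{: lift}| * (2 * (2 * (K * m.+1) + 2) * n))).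
Proof.
move=> HD n0 C2 nC hn; set Q := K * (m - j) + (D + D).
have QQ : Q + #|G| <= Qmax by rewrite /Q /Qmax -!addnA.
have G0 : 0 < #|G|.
  apply/card_gt0P; have /and3P[+ _ _] := ham1.
  by case: (c1) => // u c _; exists u.
apply: leq_trans (card_dep_ge (fun s => card_loose_fiber HD)) _.
set S := [set z | _]; pose f (z : lift * (V * V)) := (z.1, z.2.1, z.2.2).
have finj : injective f by move=> [? [? ?]] [? [? ?]] [-> -> ->].
apply: leq_trans (_ : _ <= #|loose_pairs c1 (target j) j Q|) _.
  rewrite -(card_imset _ finj); apply/subset_leq_card/subsetP => _ /imsetP[[s [a b]] + ->].
  by rewrite [in X in X -> _]in_set /= => /andP[_]; rewrite in_set.
apply: leq_trans (_ : _ <= #|G| ^ 4 * (3 * (2 * C) ^ #|G| *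
    (#|target j| * (2 * (2 * (K * m.+1) + 2) * n)))) _; last first.
  by rewrite !leq_mul2l leq_mul2r max_card !orbT.
pose P w w1 ws z g k := k <= #|G| /\ walk c2 g ws z k w w1.
(* [card_loose] expects the length of the walk as a function, so it is obtained by choice from a
   statement that is vacuous when the hypotheses fail. *)
have ex w w1 ws z g : exists k, orientation c1 g -> cycle_edge c2 w w1 -> cycle_edge c2 ws z ->
    P w w1 ws z g k.
  case: (pselect (orientation c1 g /\ cycle_edge c2 w w1 /\ cycle_edge c2 ws z)) =>
    [[og [H1 H2]]|N].
    by have [k kG W] := walk_exists ham2 nonbip og H1 H2; exists k.
  by exists 0 => og H1 H2; case: N.
apply: (card_loose ham1 ham2 disj target_swallow target_close (@target_robust j)
  (m := fun w w1 ws z g => projT1 (cid (ex w w1 ws z g))) _ n0 C2 nC QQ _ G0).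
  by move=> w w1 ws z g og H1 H2; case: (cid _) => k /= /(_ og H1 H2).
apply: leq_trans hn; rewrite leq_mul2l; apply/orP; right.
have QQ' : Q <= Qmax by apply: leq_trans QQ; apply: leq_addr.
by rewrite leq_add // leq_mul2l leq_add2l leq_mul2l ltnS QQ' !orbT.
Qed.

End Targets.

(** * Typical lifts *)

Lemma perm_imset_exists (T : finType) (A B : {set T}) : #|A| = #|B| ->
  exists r : {perm T}, r @: A = B.
Proof.
move=> AB; have ABc : #|~: A| = #|~: B| by apply: (@addnI #|A|); rewrite cardsC {1}AB cardsC.
pose f x := if x \in A then nth x (enum B) (index x (enum A))
            else nth x (enum (~: B)) (index x (enum (~: A))).
have fA x : x \in A -> f x \in B.
  by rewrite /f => xA; rewrite xA -mem_enum mem_nth // -cardE -AB cardE index_mem mem_enum.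
have fC x : x \notin A -> f x \in ~: B.
  move=> xA; rewrite /f (negbTE xA) -mem_enum mem_nth // -cardE -ABc cardE index_mem.
  by rewrite mem_enum in_setC.
have nthI (C D : {set T}) x y : #|C| = #|D| -> x \in C -> y \in C ->
    nth x (enum D) (index x (enum C)) = nth y (enum D) (index y (enum C)) -> x = y.
  move=> CD xC yC; have ix z : z \in C -> index z (enum C) < size (enum D).
    by move=> zC; rewrite -cardE -CD cardE index_mem mem_enum.
  rewrite (set_nth_default y) ?ix // => /eqP; rewrite nth_uniq ?enum_uniq ?ix //.
  by move/eqP => E; rewrite -(nth_index x (_ : x \in enum C)) ?E ?nth_index ?mem_enum.
have finj : injective f.
  move=> x y; case: (boolP (x \in A)) (boolP (y \in A)) => xA [] yA E.
  - by move: E; rewrite /f xA yA; apply: nthI.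
  - by have := fC _ yA; rewrite -E in_setC (fA _ xA).
  - by have := fC _ xA; rewrite E in_setC (fA _ yA).
  - by move: E; rewrite /f (negbTE xA) (negbTE yA); apply: nthI; rewrite ?in_setC.
exists (perm finj); apply/eqP; rewrite eqEcard card_imset ?AB ?leqnn ?andbT; last exact: perm_inj.
by apply/subsetP => _ /imsetP[x xA ->]; rewrite permE fA.
Qed.

(** * Invariant families: the number of lifted cycles and connectivity *)

Section ClosedSets.
Variables (G : sgraph) (n : nat).
Local Notation V := (G * 'I_n)%type.
Local Notation lift := {ffun edge G -> 'S_n}.
Implicit Types (s : lift) (es : seq (edge G)) (U : {ffun G -> {set 'I_n}}).

Definition invariant_on es s U :=
  all (fun e : edge G => s e @: U (val e).1 == U (val e).2) es.

Definition update s e (r : 'S_n) : lift := [ffun e' => if e' == e then (s e * r)%g else s e'].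

(** Each edge [e] gains a factor ['C(n, a)]: composing its matching with a permutation that sends
    [U (val e).2] onto any prescribed set [B] of size [a] keeps the constraints over the other
    edges, and the result determines [s] and [B]. *)
Lemma card_invariant_on es U a : uniq es -> (forall u, #|U u| = a) ->
  #|[set s | invariant_on es s U]| * 'C(n, a) ^ size es <= #|{: lift}|.
Proof.
move=> + cU; elim: es => [|e es IH] /=; first by rewrite expn0 muln1 max_card.
case/andP => ees /IH; apply: leq_trans; rewrite expnS mulnA leq_mul2r; apply/orP; right.
pose D := [set B : {set 'I_n} | #|B| == a].
have cD : 'C(n, a) = #|D| by rewrite card_draws card_ord.
have ex (B : {set 'I_n}) : exists r : 'S_n, B \in D -> r @: U (val e).2 = B.
  case: (boolP (B \in D)) => [|_]; last by exists 1%g.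
  by rewrite inE => /eqP cB; have [r Hr] :=
    @perm_imset_exists _ (U (val e).2) B (etrans (cU _) (esym cB)); exists r.
pose r B := projT1 (cid (ex B)).
have rE B : B \in D -> r B @: U (val e).2 = B := projT2 (cid (ex B)).
set S := [set s | invariant_on (e :: es) s U].
pose f (z : lift * {set 'I_n}) := update z.1 e (r z.2).
rewrite cD -cardsX.
have img s B : s \in S -> B \in D -> (update s e (r B) e) @: U (val e).1 = B.
  rewrite in_set /= => /andP[/eqP sU _] BD; rewrite ffunE eqxx.
  rewrite (eq_imset (g := r B \o s e)) => [|i]; last by rewrite permM.
  by rewrite imset_comp sU rE.
have finj : {in finset.setX S D &, injective f}.
  move=> [s B] [s' B'] /setXP[/= sS BD] /setXP[/= sS' BD'] E.
  have EB : B = B' by rewrite -(img _ _ sS BD) -(img _ _ sS' BD') -[update s _ _]/(f (s, B)) E.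
  subst B'; congr (_, _); apply/ffunP => e'.
  move/ffunP/(_ e'): E; rewrite /f /= !ffunE; case: eqP => [->|//].
  exact: mulIg.
rewrite -(card_in_imset finj); apply/subset_leq_card/subsetP => _ /imsetP[[s B] /setXP[/= sS _] ->].
rewrite in_set; move: sS; rewrite in_set /= => /andP[_ /allP inv].
apply/allP => e' e'es; rewrite ffunE; case: (e' =P e) => [E|_]; last exact: (inv _ e'es).
by rewrite -E e'es in ees.
Qed.

Definition equisized a : {set {ffun G -> {set 'I_n}}} :=
  [set U : {ffun G -> {set 'I_n}} | [forall u, #|U u| == a]].

Lemma card_equisized a : #|equisized a| = 'C(n, a) ^ #|G|.
Proof.
rewrite -[n in 'C(n, _)]card_ord -card_draws -card_ffun_on; apply: eq_card => U.
rewrite inE; apply/forallP/ffun_onP => H u; move: (H u); by rewrite inE.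
Qed.

(** There are ['C(n, a) ^ #|G|] families, so [#|G|] edges compensate for their number and the [k]
    further edges are pure gain. *)
Lemma sum_invariant_on es a k : uniq es -> #|G| + k <= size es -> a <= n ->
  (\sum_(U in equisized a) #|[set s | invariant_on es s U]|) * 'C(n, a) ^ k <= #|{: lift}|.
Proof.
move=> Ues sz an; have C0 : 0 < 'C(n, a) by rewrite bin_gt0.
have P0 : 0 < 'C(n, a) ^ #|G| by rewrite expn_gt0 C0.
rewrite -(leq_pmul2r P0) -mulnA -expnD [k + _]addnC [leqRHS]mulnC -card_equisized.
rewrite big_distrl /= -sum_nat_const; apply: leq_sum => U.
rewrite inE => /forallP HU.
apply: leq_trans (card_invariant_on (a := a) Ues (fun u => eqP (HU u))).
by rewrite leq_mul2l leq_pexp2l ?orbT.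
Qed.

Lemma invariant_card es s U (r : rel G) : invariant_on es s U ->
  (forall u v, r u v -> exists2 e, e \in es & val e = (u, v) \/ val e = (v, u)) ->
  forall u v, connect r u v -> #|U u| = #|U v|.
Proof.
move=> /allP inv rE u v /connectP[p + ->]; elim: p u => //= w p IH u /andP[/rE[e ees He] /IH <-].
have := inv _ ees; case: He => -> /= /eqP <-; rewrite card_imset //; exact: perm_inj.
Qed.

End ClosedSets.

Section Events.
Variables (G : sgraph) (n : nat) (c1 c2 : seq G).
Hypotheses (ham1 : hamilton_cycle c1) (ham2 : hamilton_cycle c2).
Hypothesis disj : edge_disjoint c1 c2.
Local Notation V := (G * 'I_n)%type.
Local Notation lift := {ffun edge G -> 'S_n}.
Implicit Types (s : lift).

Definition edges_of (c : seq G) := [seq e <- enum {: edge G} | cycle_edge c (val e).1 (val e).2].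

Lemma mem_edges_of c u v : hamilton_cycle c -> cycle_edge c u v ->
  exists2 e, e \in edges_of c & val e = (u, v) \/ val e = (v, u).
Proof.
move=> H uv; case: (adj_edge (ham_adj H uv)) => e He; exists e; rewrite ?He; auto.
  by rewrite mem_filter mem_enum He uv.
by rewrite mem_filter mem_enum He (ham_edge_sym _ _ H) uv.
Qed.

Lemma size_edges_of c : hamilton_cycle c -> #|G| <= size (edges_of c).
Proof.
move=> H; have nx w : cycle_edge c w (next c w) by rewrite ham_edge // eqxx.
have ex w : exists e, e \in edges_of c /\ (val e = (w, next c w) \/ val e = (next c w, w)).
  by have [e ? ?] := mem_edges_of H (nx w); exists e.
pose f w := projT1 (cid (ex w)).
have fE w : f w \in edges_of c /\ (val (f w) = (w, next c w) \/ val (f w) = (next c w, w)) :=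
  projT2 (cid (ex w)).
have finj : injective f.
  move=> w v E; have [_ Hw] := fE w; have [_] := fE v; rewrite -E.
  have n2 x : next c (next c x) = x -> False by move/eqP; rewrite (negbTE (ham_next2 x H)).
  case: Hw => -> [] [] // E1 E2; first by case: (n2 v); rewrite -E1.
  by case: (n2 v); rewrite -E2.
apply: leq_trans (_ : #|f @: finset.setT| <= _); first by rewrite card_imset // cardsT.
apply: leq_trans (card_size _); apply/subset_leq_card/subsetP => _ /imsetP[w _ ->]; by case: (fE w).
Qed.

Lemma imset_perm (r : 'S_n) (A B : {set 'I_n}) :
  (forall x, (r x \in B) = (x \in A)) -> r @: A = B.
Proof.
move=> H; apply/setP => y; apply/imsetP/idP => [[x xA ->]|yB]; first by rewrite H.
by exists ((r^-1)%g y); rewrite ?permKV // -H permKV.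
Qed.

(** Markov's inequality for 2 to the number of lifted cycles: this power counts the unions of lifted
    cycles. They are invariant families, and for each fiber size [a <= n] the expected number of
    these is at most 1. *)
Lemma card_orbits m :
  #|[set s : lift | m <= #|[set x | froots (hsucc c1 s) x]|]| * 2 ^ m <= n.+1 * #|{: lift}|.
Proof.
set es := edges_of c1; have Ues : uniq es by rewrite filter_uniq ?enum_uniq.
have G0 : exists u0 : G, True.
  by have /and3P[+ _ _] := ham1; case: (c1) => // u c _; exists u.
case: G0 => u0 _.
pose J s := [set U : {ffun G -> {set 'I_n}} | invariant_on es s U].
have lo s : s \in [set s : lift | m <= #|[set x | froots (hsucc c1 s) x]|] -> 2 ^ m <= #|J s|.
  rewrite inE => ms; apply: (@leq_trans (2 ^ #|[set x | froots (hsucc c1 s) x]|)).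
    by rewrite leq_pexp2l.
  have fsym := fconnect_sym (@hsucc_inj _ _ _ ham1 s).
  rewrite -card_powerset.
  pose F (R : {set V}) : {ffun G -> {set 'I_n}} :=
    [ffun u => [set i | froot (hsucc c1 s) (u, i) \in R]].
  have Finj : {in powerset [set x | froots (hsucc c1 s) x] &, injective F}.
    move=> A B; rewrite !inE => /subsetP sA /subsetP sB E; apply/setP => -[u i].
    move/ffunP/(_ u): E; rewrite !ffunE => /setP/(_ i); rewrite !inE.
    case: (boolP (froots (hsucc c1 s) (u, i))) => [/eqP-> //|N _].
    by apply/idP/idP => [/sA|/sB]; rewrite inE (negbTE N).
  rewrite -(card_in_imset Finj); apply/subset_leq_card/subsetP => _ /imsetP[R _ ->].
  rewrite inE; apply/allP => e; rewrite mem_filter ham_edge // => /andP[he _].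
  apply/eqP/imset_perm => i; rewrite !ffunE !inE.
  have -> // : froot (hsucc c1 s) ((val e).2, s e i) = froot (hsucc c1 s) ((val e).1, i).
  apply/eqP; rewrite (root_connect fsym).
  case/orP: he => /eqP he.
    rewrite fsym; have -> : ((val e).2, s e i) = hsucc c1 s ((val e).1, i).
      by rewrite /hsucc /= -he fiber_permE.
    exact: fconnect1.
  have -> : ((val e).1, i) = hsucc c1 s ((val e).2, s e i).
    by rewrite /hsucc /= -he fiber_permEV permK.
  exact: fconnect1.
apply: leq_trans (card_dep_ge lo) _.
apply: leq_trans (_ : \sum_(a < n.+1) \sum_(U in equisized G n a) #|[set s | invariant_on es s U]| <= _); last first.
  have -> : n.+1 * #|{: lift}| = \sum_(a < n.+1) #|{: lift}| by rewrite sum_nat_const card_ord.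
  apply: leq_sum => a _.
  have := @sum_invariant_on _ n es a 0 Ues; rewrite expn0 muln1 addn0; apply.
    exact: size_edges_of.
  by rewrite -ltnS.
rewrite (exchange_big_dep predT) //=.
apply: leq_trans (_ : \sum_U #|[set s | invariant_on es s U]| <= _); last first.
  apply: leq_sum => U _.
  (* A family invariant under some lift has the same size on all fibers, read off at [u0]; the other
     families contribute nothing. *)
  case: (boolP [exists s, invariant_on es s U]) => [/existsP[s inv]|N].
    have aN : #|U u0| < n.+1 by rewrite ltnS -[n in _ <= n]card_ord max_card.
    rewrite (bigD1 (Ordinal aN)) ?leq_addr //=.
    rewrite inE; apply/forallP => u; rewrite eq_sym; apply/eqP.
    apply: (invariant_card inv (r := frel (next c1))) => [v w /eqP <-|].
      by apply: mem_edges_of => //; rewrite ham_edge // eqxx.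
    exact: ham_connect.
  rewrite eq_card0 // => s; rewrite inE; apply: contraNF N => inv; apply/existsP; by exists s.
pose I (U : {ffun G -> {set 'I_n}}) := [set s | invariant_on es s U].
have <- : #|[set z : {ffun G -> {set 'I_n}} * lift | (z.1 \in finset.setT) && (z.2 \in I z.1)]| =
    \sum_U #|I U|.
  by rewrite card_dep; apply: eq_bigl => U; rewrite inE.
pose sw (z : lift * {ffun G -> {set 'I_n}}) := (z.2, z.1).
have swinj : injective sw by move=> [? ?] [? ?] [-> ->].
rewrite -[leqLHS](card_imset _ swinj); apply/subset_leq_card/subsetP => _ /imsetP[[s U] + ->].
by rewrite !inE /= => /andP[].
Qed.

Lemma leq_bin_pos a : 0 < a < n -> n <= 'C(n, a).
Proof.
elim: n a => // n' IH [|a] //= an; rewrite binS.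
rewrite ltnS leq_eqVlt in an; case/predU1P: an => [<-|lt]; first by rewrite binn binSn.
have := IH a.+1; rewrite lt => /(_ isT) le1; rewrite -addn1; apply: leq_add le1 _.
by rewrite bin_gt0 ltnW // ltnW.
Qed.

Lemma edges_of_uniq : uniq (edges_of c1 ++ edges_of c2).
Proof.
rewrite cat_uniq; apply/and3P; split; try by rewrite filter_uniq ?enum_uniq.
apply/hasPn => e.
rewrite !mem_filter => /andP[h2 _]; apply/negP => /andP[h1 _].
by have := disj (val e).1 (val e).2; rewrite h1 h2.
Qed.

(** A proper nonempty vertex set that no edge leaves is an invariant family over both cycles, of
    constant size [a] with [0 < a < n]. The two edges beyond [#|G|] bound the expected number for
    each [a] by the inverse square of ['C(n, a) >= n], and there are fewer than [n] values of
    [a]. *)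
Lemma card_disconnected : 0 < n ->
  #|[set s : lift | ~~ `[< lift_connected s >]]| * n <= #|{: lift}|.
Proof.
move=> n0; set es := edges_of c1 ++ edges_of c2; have Ues : uniq es := edges_of_uniq.
have [u0 _] : exists u0 : G, True.
  by have /and3P[+ _ _] := ham1; case: (c1) => // u c _; exists u.
have G2 : 2 <= #|G|.
  have /and3P[sz _ _] := ham1; apply: ltnW; apply: leq_trans sz _.
  by rewrite -(card_uniqP (ham_uniq ham1)) max_card.
have sz : #|G| + 2 <= size es.
  rewrite size_cat; apply: leq_add (size_edges_of ham1) _.
  exact: leq_trans G2 (size_edges_of ham2).
pose A := [set x : 'I_n * {ffun G -> {set 'I_n}} | (0 < x.1) && (x.2 \in equisized G n x.1)].
pose I (x : 'I_n * {ffun G -> {set 'I_n}}) := [set s | invariant_on es s x.2].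
set B := [set s : lift | _].
pose J s := [set x in A | s \in I x].
have lo s : s \in B -> 1 <= #|J s|.
  rewrite [s \in B]inE => nc; apply: contraR nc; rewrite -leqNgt leqn0 cards_eq0 => /eqP J0.
  apply/asboolP => U /set0Pn[[u i] ui] UT.
  case: (pselect (exists x d, [/\ x \in U, d \notin U & lift_adj s x d])) => // N; exfalso.
  have cl x d : lift_adj s x d -> (d \in U) = (x \in U).
    move=> xd; apply/idP/idP => H; apply: contraT => H'; case: N; last by exists x, d.
    by exists d, x; rewrite lift_adj_sym.
  pose F : {ffun G -> {set 'I_n}} := [ffun w => [set k | (w, k) \in U]].
  have inv : invariant_on es s F.
    apply/allP => e _; apply/eqP/imset_perm => k; rewrite !ffunE !inE; apply: cl.
    by rewrite lift_adjE /= edge_adj fiber_permE eqxx.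
  have same v w : #|F v| = #|F w|.
    apply: (invariant_card inv (r := frel (next c1))); last exact: ham_connect.
    move=> v' w' /eqP <-; have [|e ee He] := @mem_edges_of c1 v' (next c1 v') ham1.
      by rewrite ham_edge // eqxx.
    by exists e; rewrite // mem_cat ee.
  have pos : 0 < #|F u| by apply/card_gt0P; exists i; rewrite ffunE inE.
  have ltn : #|F u| < n.
    have [[v k] vk] : exists x, x \notin U.
      apply/existsP; apply: contraR UT => /existsPn H; apply/eqP/setP => x.
      by rewrite finset.in_setT; apply: negbNE.
    rewrite (same u v) -[n in _ < n]card_ord -cardsT; apply: proper_card.
    by apply/properP; split; [apply: subsetT | exists k; rewrite ?inE // ffunE inE].
  have : (Ordinal ltn, F) \in J s.
    rewrite !in_set /= pos inv andbT; apply/forallP => w; exact/eqP.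
  by rewrite J0 in_set0.
have := card_dep_ge lo; rewrite muln1; set S := [set z | _] => cS.
have cA : #|B| <= \sum_(x in A) #|I x|.
  apply: leq_trans cS _; rewrite -card_dep.
  pose sw (z : lift * ('I_n * {ffun G -> {set 'I_n}})) := (z.2, z.1).
  have swinj : injective sw by move=> [? ?] [? ?] [-> ->].
  rewrite -[leqLHS](card_imset _ swinj); apply/subset_leq_card/subsetP => _ /imsetP[[s x] + ->].
  by rewrite [in X in X -> _]in_set /= => /andP[_]; rewrite in_set => /andP[xA sx];
    rewrite in_set /= xA sx.
have cI : (\sum_(x in A) #|I x|) * (n * n) <= n * #|{: lift}|.
  have -> : \sum_(x in A) #|I x| = \sum_(a < n | 0 < a) \sum_(U in equisized G n a) #|I (a, U)|.
    by rewrite pair_big_dep /=; apply: eq_big => [[a U]|[a U] _] //; rewrite in_set.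
  rewrite big_distrl /=.
  apply: leq_trans (_ : \sum_(a < n | 0 < a) #|{: lift}| <= _); last first.
    rewrite sum_nat_const leq_mul2r; apply/orP; right.
    by rewrite -[n in _ <= n]card_ord max_card.
  apply: leq_sum => a a0; apply: leq_trans (sum_invariant_on Ues sz (ltnW (ltn_ord a))).
  by rewrite leq_mul2l expnS expn1 leq_mul ?orbT // leq_bin_pos // a0 ltn_ord.
by rewrite -(leq_pmul2l n0) mulnCA; apply: leq_trans cI; rewrite leq_mul2r cA orbT.
Qed.

End Events.

(** * Sparsity and expansion of small sets *)

Section Sparse.
Variables (G : sgraph) (n : nat).
Local Notation V := (G * 'I_n)%type.
Local Notation lift := {ffun edge G -> 'S_n}.
Local Notation pin := (edge G * 'I_n * 'I_n)%type.
Implicit Types (s : lift) (T S A : {set V}).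

Definition pinned s (l : seq pin) := all (fun f : pin => s f.1.1 f.1.2 == f.2) l.

(** Each pin has probability at most [2 / n] given the others: its value [j] can be exchanged with
    any of the at least [n / 2] values that no other pin prescribes, and the other pins are kept. *)
Lemma card_pinned l : uniq l -> 2 * size l <= n ->
  #|[set s | pinned s l]| * n ^ size l <= 2 ^ size l * #|{: lift}|.
Proof.
elim: l => [|[[e i] j] l IH] /=; first by rewrite !expn0 muln1 mul1n max_card.
case/andP => fl Ul sz; have /(IH Ul) {}IH : 2 * size l <= n.
  by apply: leq_trans sz; rewrite leq_mul2l leqnSn orbT.
rewrite !expnS; set B := [set s | pinned s l] in IH *; set A := [set s | _].
suff key : #|A| * n <= 2 * #|B|.
  rewrite mulnA; apply: leq_trans (leq_mul key (leqnn _)) _.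
  by rewrite -!mulnA leq_mul2l IH.
pose D := [set j' : 'I_n | j' \notin [seq f.2 | f <- l]].
have cD : n <= 2 * #|D|.
  have cl : #|~: D| <= size l.
    rewrite -(size_map (fun f : pin => f.2)); apply: leq_trans (card_size _).
    by apply/subset_leq_card/subsetP => x; rewrite !inE negbK.
  have := cardsC D; rewrite card_ord; move: #|D| #|~: D| (size l) cl sz; clear; lia.
pose f (z : lift * 'I_n) := update z.1 e (tperm j z.2).
have sA s : s \in A -> s e i = j by rewrite in_set /= => /andP[/eqP].
have finj : {in finset.setX A D &, injective f}.
  move=> [s j1] [s' j2] /setXP[/sA sj _] /setXP[/sA s'j _] /ffunP E.
  have Ej : j1 = j2.
    have := E e; rewrite /f /= !ffunE eqxx => /permP/(_ i).
    by rewrite !permM sj s'j !tpermL.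
  subst j2; congr (_, _); apply/ffunP => e'; have := E e'; rewrite /f /= !ffunE.
  by case: eqP => [->|//]; apply: mulIg.
apply: leq_trans (leq_mul (leqnn #|A|) cD) _; rewrite mulnCA -cardsX leq_mul2l /=.
rewrite -(card_in_imset finj); apply/subset_leq_card/subsetP => _ /imsetP[[s j']
  /setXP[/= sAA jD] ->].
rewrite in_set; apply/allP => -[[e' i'] k] fl' /=; rewrite ffunE.
have := sAA; rewrite in_set /= => /andP[/eqP sj /allP/(_ _ fl')/eqP /= sk].
case: (e' =P e) => [Ee|_]; last by rewrite sk.
subst e'; rewrite permM sk tpermD //.
  apply: contraNneq fl => jk; move: fl'; have -> : i' = i by apply: (@perm_inj _ (s e));
    rewrite sj sk.
  by rewrite jk.
by apply: contraTneq jD => ->; rewrite inE negbK; apply/mapP; exists (e, i', k).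
Qed.

Definition potential T : {set pin} :=
  [set f : pin | (((val f.1.1).1, f.1.2) \in T) && (((val f.1.1).2, f.2) \in T)].

Definition inner s T : {set pin} := [set f in potential T | s f.1.1 f.1.2 == f.2].

Lemma mem_inner s T e i j : ((e, i, j) \in inner s T) =
  [&& ((val e).1, i) \in T, ((val e).2, j) \in T & s e i == j].
Proof. by rewrite !inE -andbA. Qed.

Lemma card_potential T : #|potential T| <= #|T| * #|T|.
Proof.
rewrite -cardsX; pose f (x : pin) := (((val x.1.1).1, x.1.2), ((val x.1.1).2, x.2)).
have finj : injective f.
  move=> [[e i] j] [[e' i'] j'] [E1 -> E2 ->]; congr (_, _, _); apply: val_inj.
  by rewrite [LHS]surjective_pairing [RHS]surjective_pairing /= E1 E2.
rewrite -(card_imset _ finj); apply/subset_leq_card/subsetP => _ /imsetP[x + ->].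
by rewrite inE => /andP[? ?]; apply/setXP.
Qed.

Definition dense t mu : {set lift} :=
  [set s | [exists T : {set V}, (#|T| == t) && (mu <= #|inner s T|)]].

(** Union bound over the sets of [t] vertices and the sets of [mu] potential edges inside them. *)
Lemma card_dense t mu : 2 * mu <= n ->
  #|dense t mu| * n ^ mu <= 'C(#|G| * n, t) * 'C(t * t, mu) * (2 ^ mu * #|{: lift}|).
Proof.
move=> mun; pose P := {set V}%type.
pose A := [set x : {set V} * {set pin} |
  (x.1 \in [set T : {set V} | #|T| == t]) &&
  (x.2 \in [set F : {set pin} | (F \subset potential x.1) && (#|F| == mu)])].
have cA : #|A| <= 'C(#|G| * n, t) * 'C(t * t, mu).
  have cF (T : {set V}) : T \in [set T : {set V} | #|T| == t] ->
      #|[set F : {set pin} | (F \subset potential T) && (#|F| == mu)]| <= 'C(t * t, mu).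
    by rewrite inE => /eqP cT; rewrite cards_draws leq_bin2l // -cT card_potential.
  by apply: leq_trans (card_dep_le cF) _; rewrite card_draws card_prod card_ord.
pose I (x : {set V} * {set pin}) := [set s | pinned s (enum x.2)].
have lo s : s \in dense t mu -> 1 <= #|[set x in A | s \in I x]|.
  rewrite inE => /existsP[T /andP[cT big]].
  have : 0 < #|[set F : {set pin} | (F \subset inner s T) && (#|F| == mu)]|.
    by rewrite cards_draws bin_gt0.
  case/card_gt0P => F; rewrite inE => /andP[/subsetP FT cF].
  apply/card_gt0P; exists (T, F); rewrite !in_set /= cT cF andbT /=; apply/andP; split.
    by apply/subsetP => f /FT; rewrite in_set => /andP[].
  by apply/allP => f; rewrite mem_enum => /FT; rewrite in_set => /andP[].
have := card_dep_ge lo; rewrite muln1; set S := [set z | _] => cS.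
have cA' : #|dense t mu| <= \sum_(x in A) #|I x|.
  apply: leq_trans cS _; rewrite -card_dep.
  pose sw (z : lift * ({set V} * {set pin})) := (z.2, z.1).
  have swinj : injective sw by move=> [? ?] [? ?] [-> ->].
  rewrite -[leqLHS](card_imset _ swinj); apply/subset_leq_card/subsetP => _ /imsetP[[s x] + ->].
  by rewrite [in X in X -> _]in_set /= => /andP[_]; rewrite in_set => /andP[xA sx];
    rewrite in_set /= xA sx.
apply: leq_trans (leq_mul cA' (leqnn _)) _; rewrite big_distrl /=.
apply: leq_trans (_ : \sum_(x in A) (2 ^ mu * #|{: lift}|) <= _); last first.
  by rewrite sum_nat_const leq_mul2r cA orbT.
apply: leq_sum => -[T F]; rewrite !in_set /= => /and3P[_ _ /eqP cF].
have := @card_pinned (enum F) (enum_uniq _); rewrite -cardE cF; exact.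
Qed.

Lemma ffact_leq_expn x k : x ^_ k <= x ^ k.
Proof.
elim: k => [|k IH]; first by rewrite ffactn0 expn0.
by rewrite ffactnSr expnSr leq_mul // leq_subr.
Qed.

(** The falling factorial [(x + x) ^_ x] lies in between; it is the factorial of [x] times a central
    binomial coefficient, which is at most [4 ^ x]. *)
Lemma expn_self_fact x : x ^ x <= 4 ^ x * x`!.
Proof.
have H1 : x ^ x <= (x + x) ^_ x.
  rewrite -[X in X ^ _]/x ffact_prod -[X in _ ^ X]card_ord -prod_nat_const.
  by apply: leq_prod => i _; have := ltn_ord i; lia.
apply: leq_trans H1 _; rewrite -bin_ffact leq_mul2r; apply/orP; right.
have := expnDn 1 1 (x + x); rewrite -[1 + 1]/2 addnn -mul2n expnM => ->.
have xx : x < (2 * x).+1 by lia.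
by rewrite (bigD1 (Ordinal xx)) //= !exp1n !muln1 leq_addr.
Qed.

(* With [r] edges in excess on [t <= n / z] vertices, the union bound over vertex sets and
   edge sets is [(256 |G|) ^ t / z ^ r]. *)
Lemma card_dense_excess t r z : 0 < t -> r <= t -> 2 * (t + r) <= n -> t * z <= n ->
  #|dense t (t + r)| * z ^ r <= (256 * #|G|) ^ t * #|{: lift}|.
Proof.
move=> t0 rt trn tz; have n0 : 0 < n by lia.
have := card_dense t trn; set b := #|dense t _|; set O := #|{: lift}|; set k := #|G| => H.
have f1 : 'C(k * n, t) * t`! <= (k * n) ^ t.
  by rewrite bin_ffact; apply: ffact_leq_expn.
have f2 : 'C(t * t, t + r) * (t + r)`! <= (t * t) ^ (t + r).
  by rewrite bin_ffact; apply: ffact_leq_expn.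
have g1 := expn_self_fact t.
have g2 : t ^ (t + r) <= 4 ^ (t + r) * (t + r)`!.
  by apply: leq_trans (expn_self_fact _); rewrite leq_exp2r ?addn_gt0 ?t0 ?leq_addr.
have H1 : b * n ^ (t + r) * (t ^ t * t ^ (t + r)) <=
    (k * n) ^ t * (t * t) ^ (t + r) * (2 ^ (t + r) * O) * (4 ^ t * 4 ^ (t + r)).
  apply: leq_trans (leq_mul (leqnn _) (leq_mul g1 g2)) _.
  rewrite [X in _ * X]mulnACA mulnCA [leqRHS]mulnC leq_mul2l; apply/orP; right.
  apply: leq_trans (leq_mul H (leqnn (t`! * (t + r)`!))) _.
  apply: leq_trans (leq_mul (leq_mul f1 f2) (leqnn (2 ^ (t + r) * O))); rewrite -/O.
  move: 'C(k * n, t) 'C(t * t, t + r) (2 ^ _) t`! (t + r)`!; clear=> x1 x2 x3 x4 x5.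
  by lia.
have H2 : b * n ^ r <= (256 * k) ^ t * O * t ^ r.
  have N0 : 0 < n ^ t * (t ^ t * (t ^ t * t ^ r)) by rewrite !muln_gt0 !expn_gt0 n0 t0.
  rewrite -(leq_pmul2r N0); apply: leq_trans (_ : _ <= b * n ^ (t + r) * (t ^ t * t ^ (t + r))) _.
    by rewrite !expnD; lia.
  apply: leq_trans H1 _.
  (* As [r <= t], the left side is at most [2 ^ (2 * t) * 4 ^ (3 * t)]. *)
  have F : 2 ^ (t + r) * (4 ^ t * 4 ^ (t + r)) <= 256 ^ t.
    apply: leq_trans (_ : 2 ^ (t + t) * (4 ^ t * 4 ^ (t + t)) <= _).
      by rewrite !leq_mul // leq_exp2l // leq_add2l.
    by rewrite !expnD -!expnMn.
  rewrite !expnMn !expnD; move: F; rewrite !expnD.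
  move: (2 ^ t) (2 ^ r) (4 ^ t) (4 ^ r) (256 ^ t) (k ^ t) (n ^ t) (t ^ t) (t ^ r).
  clear=> a2 b2 a4 b4 x kk nn tt tr F.
  apply: leq_trans (_ : (a2 * b2 * (a4 * (a4 * b4))) * (kk * O * tr * (nn * (tt * (tt * tr)))) <=
    _).
    by lia.
  apply: leq_trans (leq_mul F (leqnn _)) _.
  by lia.
have tr0 : 0 < t ^ r by rewrite expn_gt0 t0.
rewrite -(leq_pmul2r tr0); apply: leq_trans H2.
rewrite -mulnA -expnMn leq_mul2l [z * t]mulnC.
by apply/orP; right; case: (r) => // r'; rewrite leq_exp2r.
Qed.

Lemma lift_degree s x : degree x.1 <= #|[set y | lift_adj s x y]|.
Proof.
pose f v := (v, fiber_perm s x.1 v x.2) : V.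
have finj : injective f by move=> u v [].
rewrite /degree -[leqLHS](card_imset _ finj).
apply/subset_leq_card/subsetP => _ /imsetP[v + ->].
by rewrite !inE lift_adjE /= => ->; rewrite eqxx.
Qed.

(** An edge meeting [S] lies inside [S] together with its neighbourhood, and the degree sum over [S]
    counts it twice only if both its ends are in [S]. *)
Lemma degree_sum s S d : (forall u : G, d <= degree u) ->
  #|S| * d <= #|inner s (S :|: nbhd (lift_adj s) S)| + #|inner s S|.
Proof.
move=> mindeg; set T := S :|: _.
have := card_dep_ge (A := S) (fun x _ => leq_trans (mindeg x.1) (lift_degree s x)).
set DP := [set z | _]; pose src (f : pin) : V := ((val f.1.1).1, f.1.2).
pose tgt (f : pin) : V := ((val f.1.1).2, f.2).
pose I1 := [set f in inner s T | src f \in S]; pose I2 := [set f in inner s T | tgt f \in S].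
move/leq_trans; apply; apply: leq_trans (_ : #|I1| + #|I2| <= _).
  apply: leq_trans (_ : #|[set (src f, tgt f) | f in I1] :|: [set (tgt f, src f) | f in I2]| <= _).
    apply/subset_leq_card/subsetP => -[x y]; rewrite [in X in X -> _]in_set /= => /andP[xS].
    rewrite in_set => xy.
    have yT : y \in T by rewrite in_setU in_set; apply/orP; right; apply/exists_inP; exists x.
    have xT : x \in T by rewrite in_setU xS.
    case/existsP: xy => e /orP[] /andP[/eqP He /eqP Hs]; rewrite in_setU; apply/orP; [left|right].
      apply/imsetP; exists (e, x.2, y.2); last by rewrite /src /tgt He /= -!surjective_pairing.
      by rewrite in_set mem_inner /src /= He /= Hs eqxx -!surjective_pairing xT yT xS.
    apply/imsetP; exists (e, y.2, x.2); last by rewrite /src /tgt He /= -!surjective_pairing.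
    by rewrite in_set mem_inner /tgt /= He /= Hs eqxx -!surjective_pairing xT yT xS.
  by apply: leq_trans (leq_card_setU _ _) _; rewrite leq_add ?leq_imset_card.
rewrite -cardsUI; apply: leq_add; apply/subset_leq_card/subsetP => f.
  by rewrite in_setU => /orP[]; rewrite in_set => /andP[].
rewrite in_setI => /andP[]; rewrite [f \in I1]in_set [f \in I2]in_set => /andP[fT fS] /andP[_ fS'].
case: f fT fS fS' => [[e i] j]; rewrite !mem_inner /src /tgt /= => /and3P[_ _ ->] -> ->.
by [].
Qed.

(** Let [N] be the neighbourhood of [A]. With fewer than 7/6 edges per vertex inside [A] and inside
    the union of [A] and [N], [degree_sum] yields [5 |A| < 7/6 (2 |A| + |N - A|)], so
    [|N - A| > 16/7 |A|], and 16/7 exceeds 9/4. If the union has more than [4 * M] elements, the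
    expansion is immediate. *)
Lemma sparse_expanding s M : (forall u : G, 5 <= degree u) ->
  (forall t, 0 < t <= 4 * M -> s \notin dense t (t + (t + 5) %/ 6)) -> expanding M s.
Proof.
move=> mindeg sp A /andP[A0 AM]; set N := nbhd _ _.
have cT : #|A :|: N| = #|A| + #|N :\: A|.
  by rewrite cardsU cardsD [N :&: A]setIC addnBA // subset_leq_card // subsetIr.
have few T : 0 < #|T| <= 4 * M -> #|inner s T| < #|T| + (#|T| + 5) %/ 6.
  move/sp; rewrite in_set ltnNge; apply: contra => H; apply/existsP; exists T; by rewrite eqxx.
have [big|small] := ltnP (4 * M) #|A :|: N|.
  by move: big AM; rewrite cT; move: #|A| #|_ :\: _|; clear; lia.
have := degree_sum s A mindeg; rewrite -/N.
have := few (A :|: N); have := few A; rewrite small A0 cT.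
have -> : #|A| <= 4 * M by lia.
rewrite addn_gt0 A0 /= => /(_ isT) + /(_ isT).
by move: #|inner _ _| #|inner _ _| #|A| #|_ :\: _| A0; clear; lia.
Qed.

Lemma geometric_sum (f : nat -> nat) B m : (forall t, t < m -> f t * 2 ^ t <= B) ->
  \sum_(t < m) f t <= 2 * B.
Proof.
elim: m f B => [|m IH] f B H; first by rewrite big_ord0.
rewrite big_ord_recl mul2n -addnn; apply: leq_add; first by have := H 0 isT; rewrite muln1.
apply: leq_trans (IH (fun t => f t.+1) B./2 _) _; last by rewrite mul2n; lia.
by move=> t tT; rewrite geq_half_double -muln2 -mulnA -expnSr; apply: H.
Qed.

(** With an excess of one sixth and [z = y ^ 6], [card_dense_excess] bounds the probability for size
    [t] by the [t]-th power of [256 * #|G| / y], so the sum over [t] is dominated by a geometric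
    series of ratio at most 1/2. *)
Lemma card_not_expanding M y : (forall u : G, 5 <= degree u) -> 0 < #|G| ->
  2 * (256 * #|G|) <= y -> 4 * M * y ^ 6 <= n ->
  #|[set s : lift | ~~ `[< expanding M s >]]| * y <= 2 * (256 * #|G| * #|{: lift}|).
Proof.
move=> mindeg G0 yA Mn; set A := 256 * #|G|.
have A0 : 0 < A by rewrite muln_gt0.
have y0 : 0 < y by apply: leq_trans yA; rewrite muln_gt0.
pose f t := #|dense t.+1 (t.+1 + (t.+1 + 5) %/ 6)|.
have sub : #|[set s : lift | ~~ `[< expanding M s >]]| <= \sum_(t < 4 * M) f t.
  apply: (@leq_trans #|\bigcup_(t < 4 * M) dense t.+1 (t.+1 + (t.+1 + 5) %/ 6)|).
    apply/subset_leq_card/subsetP => s; rewrite in_set; apply: contraR => N.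
    apply/asboolP/sparse_expanding => // -[//|t] tM; apply: contra N => H.
    by apply/bigcupP; exists (Ordinal tM).
  elim/big_ind2: _ => [|B1 b1 B2 b2 H1 H2|//]; first by rewrite cards0.
  by apply: leq_trans (leq_card_setU _ _) (leq_add H1 H2).
apply: leq_trans (leq_mul sub (leqnn y)) _; rewrite big_distrl /=.
apply: (geometric_sum (f := fun t => f t * y)) => t tM.
have y6 : 4 <= y ^ 6.
  by apply: (@leq_trans (2 ^ 6)) => //; rewrite leq_exp2r //; apply: leq_trans yA;
    rewrite leq_pmulr.
have t16 : 16 * M <= n by move: Mn y6; move: (y ^ 6); clear; nia.
have := @card_dense_excess t.+1 ((t.+1 + 5) %/ 6) (y ^ 6) isT; rewrite -/(f t) -/A => H.
have {}H : f t * (y ^ 6) ^ ((t.+1 + 5) %/ 6) <= A ^ t.+1 * #|{: lift}|.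
  apply: H; [by lia | by move: t16 tM; clear; lia|].
  by apply: leq_trans Mn; rewrite leq_mul2r tM orbT.
have yt : y ^ t.+1 <= (y ^ 6) ^ ((t.+1 + 5) %/ 6).
  by rewrite -expnM leq_pexp2l //; lia.
have {}H := leq_trans (leq_mul (leqnn (f t)) yt) H.
have At : 0 < A ^ t by rewrite expn_gt0 A0.
rewrite -(leq_pmul2r At) -[leqLHS]mulnA -expnMn -mulnA.
apply: leq_trans (_ : f t * (y * y ^ t) <= _).
  rewrite !leq_mul2l; apply/orP; right; apply/orP; right.
  by case: (t) => // t'; rewrite leq_exp2r.
by rewrite -expnS; apply: leq_trans H _; rewrite expnS mulnAC.
Qed.

End Sparse.

(** * Asymptotics *)

(** Bernoulli's inequality for the powers of 9/8, at the exponent [y %/ d.+1] and raised to the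
    power [d.+1], dominates a constant multiple of [y ^ d.+1]; the additional factor [y] beats the
    constant. *)
Lemma exp_beats_poly d : exists y0, forall y, y0 <= y -> y ^ d * 8 ^ y < 9 ^ y.
Proof.
pose e := d.+1; exists ((16 * e) ^ e + e).+1 => y yb.
have ber x : 8 ^ x * x <= 9 ^ x * 8.
  suff : 8 ^ x * (x + 8) <= 9 ^ x * 8 by apply: leq_trans; rewrite leq_mul2l leq_addr orbT.
  elim: x => // x IH; rewrite !expnS -[9 * _ * 8]mulnA.
  by have := leq_mul (leqnn 9) IH; move: (8 ^ x) (9 ^ x * 8); clear; nia.
pose x := y %/ e; have yE : y = x * e + y %% e := divn_eq y e.
have re : y %% e < e by rewrite ltn_mod.
have x1 : 0 < x by rewrite divn_gt0 //; apply: leq_trans (leqW (leq_addl _ _)) yb.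
have B1 : 8 ^ y * x ^ e <= 9 ^ y * 8 ^ e.
  rewrite {1 2}yE !expnD !expnM [leqLHS]mulnAC [leqRHS]mulnAC -!expnMn.
  apply: leq_mul; first by rewrite leq_exp2r.
  by case: (y %% e) => // r; rewrite leq_exp2r.
have B2 : y <= 2 * e * x.
  rewrite {1}yE -mulnA mul2n -addnn [e * x]mulnC leq_add2l.
  by apply: leq_trans (ltnW re) _; rewrite leq_pmull.
have B3 : y ^ e <= (2 * e) ^ e * x ^ e by rewrite -expnMn leq_exp2r.
have B4 : y * (y ^ d * 8 ^ y) <= (16 * e) ^ e * 9 ^ y.
  rewrite mulnA -expnS; apply: leq_trans (leq_mul B3 (leqnn _)) _.
  rewrite -mulnA [x ^ e * _]mulnC; apply: leq_trans (leq_mul (leqnn _) B1) _.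
  by rewrite mulnCA mulnC -expnMn mulnAC.
have y0 : 0 < y by apply: leq_trans yb.
rewrite -(ltn_pmul2l y0); apply: leq_ltn_trans B4 _.
by rewrite ltn_pmul2r ?expn_gt0 //; apply: leq_trans yb; rewrite ltnS leq_addr.
Qed.

Lemma root_exists e n : 0 < e -> exists y, y ^ e <= n < y.+1 ^ e.
Proof.
move=> e0; have ex : exists y, y ^ e <= n by exists 0; rewrite exp0n.
have bd y : y ^ e <= n -> y <= n.
  by apply: leq_trans; case: (y) => // y'; rewrite -{1}[y'.+1]expn1 leq_pexp2l.
case: (ex_maxnP ex bd) => y yn ymax; exists y; rewrite yn ltnNge /=.
by apply/negP => /ymax; rewrite ltnn.
Qed.

(** With [k = #|G|], the reserve per move is [H = n %/ (16 * k)] and [C = 32 * k]: at most [k] moves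
    use at most [n / 16] turns, and [C * H] is about [2 * n], which leaves room for the subtracted
    terms. *)
Lemma threshold_bounds k q n : 0 < k -> 32 * k * (k + 5) * q.+1 <= n ->
  n <= 32 * k * (n %/ (16 * k) - k * q.+1 - (4 * q + 3)) /\
  4 * (2 * (k * (n %/ (16 * k)) + k * q.+1) + q.+1) <= n.
Proof.
move=> k0; have nE := divn_eq n (16 * k); have rn : n %% (16 * k) < 16 * k.
  by rewrite ltn_mod muln_gt0 k0.
move: nE rn; set H := n %/ _; set r := n %% _.
have -> : H * (16 * k) = 16 * (k * H) by lia.
have -> : 32 * k * (k + 5) * q.+1 = 32 * (k * (k * q.+1)) + 160 * (k * q.+1) by lia.
have -> : 32 * k * (H - k * q.+1 - (4 * q + 3)) = 32 * (k * H - k * (k * q.+1) - k * (4 * q + 3)).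
  by rewrite -mulnA !mulnBr.
have -> : k * (4 * q + 3) = 4 * (k * q.+1) - k by rewrite mulnS mulnDr; lia.
have kP : k <= k * q.+1 by rewrite leq_pmulr.
have qP : q.+1 <= k * q.+1 by rewrite leq_pmull.
move: (k * H) (k * (k * q.+1)) (k * q.+1) r kP qP; clear=> kH X P r kP qP nE rn le.
by lia.
Qed.

Lemma size_bounds k y : 0 < k -> 512 * k + 10 * k * k + 600 <= y ->
  [/\ 2 * (256 * k) <= y, (y + y + k + 2) * y.+1 <= 8 * y ^ 2 &
    32 * k * (k + 5) * ((y + y + k + 2) * y.+1).+1 <= y ^ 20].
Proof.
move=> k0 yb; have y512 : 512 * k <= y by lia.
have K4 : y + y + k + 2 <= 4 * y by lia.
have y2 : (y + y + k + 2) * y.+1 <= 8 * y ^ 2.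
  apply: leq_trans (leq_mul K4 (_ : y.+1 <= 2 * y)) _; first by lia.
  by rewrite expnS expn1; lia.
split=> //; first by lia.
apply: leq_trans (_ : (4 * y) * (9 * y ^ 2) <= _).
  apply: leq_mul; first by lia.
  have : 1 <= y ^ 2 by rewrite expn_gt0; lia.
  by move: (_ * y.+1) (y ^ 2) y2; clear; lia.
apply: leq_trans (_ : y ^ 4 <= _); last by rewrite leq_pexp2l //; lia.
rewrite !expnS expn0 muln1; have : 36 <= y by lia.
by move=> y36; have := leq_mul y36 (leqnn (y * (y * y))); clear; lia.
Qed.

(** * Assembling the bounds *)

Section Assembly.
Variables (G : sgraph) (c1 c2 : seq G).
Hypotheses (mindeg : forall u : G, 5 <= degree u).
Hypotheses (ham1 : hamilton_cycle c1) (ham2 : hamilton_cycle c2).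
Hypothesis disj : edge_disjoint c1 c2.
Hypothesis nonbip : ~ bipartite (relU (cycle_edge c1) (cycle_edge c2)).

Lemma vertex_exists : exists u : G, True.
Proof. by have /and3P[+ _ _] := ham1; case: (c1) => // u c _; exists u. Qed.

Section FixedSize.
Variables (n : nat).
Local Notation V := (G * 'I_n)%type.
Local Notation lift := {ffun edge G -> 'S_n}.
Implicit Types (s : lift).
Variables (K m D M : nat).

(** A single lifted cycle cut open is a path of cost 0. *)
Lemma few_orbits_target s : 0 < n -> #|[set x | froots (hsucc c1 s) x]| <= m ->
  s \in target n c1 K m m.+1.
Proof.
move=> n0 few; have [u _] := vertex_exists; pose x : V := (u, Ordinal n0).
have fsym := fconnect_sym (@hsucc_inj _ _ _ ham1 s).
pose f := hsucc c1 s.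
have Er : orbit f x = x :: traject f (f x) (fingraph.order f x).-1 by rewrite /orbit -orderSpred.
rewrite in_set; apply/asboolP; exists m, x, (traject f (f x) (fingraph.order f x).-1).
split=> //; rewrite -Er subnn muln0; split.
- exact: orbit_uniq.
- exact: sorted_orbit.
- by move=> y; rewrite -!fconnect_orbit; apply: (same_connect_r fsym); rewrite fsym fconnect1.
- apply: leq_trans few; apply/subset_leq_card/subsetP => y.
  by rewrite [in X in X -> _]in_set => /andP[yr _]; rewrite in_set.
by rewrite cost_orbit.
Qed.

(** Going down from [target m.+1] to [target 0], membership is lost at some level. *)
Lemma not_target_stuck s : 0 < n -> #|[set x | froots (hsucc c1 s) x]| <= m ->
  expanding M s -> lift_connected s -> s \notin target n c1 K m 0 ->
  exists j : 'I_m.+1, s \in stuck n c1 K m M j.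
Proof.
move=> n0 few Hexp Hcon s0; have sm := few_orbits_target n0 few.
have [j [jm sj sj1]] : exists j, [/\ j <= m,
  s \notin target n c1 K m j & s \in target n c1 K m j.+1].
  have : m.+1 <= m.+1 by []; move: sm; elim: {1 2}m.+1 => [|k IH] sk km; first by rewrite sk in s0.
  by have [/IH|Nk] := boolP (s \in target n c1 K m k); [apply; apply: ltnW | exists k; split].
exists (Ordinal (jm : j < m.+1)); rewrite in_set sj1 sj /=; apply/andP.
by split; apply/asboolP.
Qed.

Lemma card_not_hamiltonian : 0 < n ->
  #|[set s : lift | ~~ `[< hamiltonian (lift_graph s) >]]| <=
    #|[set s : lift | m.+1 <= #|[set x | froots (hsucc c1 s) x]|]| +
    #|[set s : lift | ~~ `[< expanding M s >]]| +
    #|[set s : lift | ~~ `[< lift_connected s >]]| +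
    \sum_(j < m.+1) #|stuck n c1 K m M j|.
Proof.
move=> n0; set A := [set s | _]; set B1 := [set s | _]; set B2 := [set s | _].
set B3 := [set s | _].
have cB : #|\bigcup_(j < m.+1) stuck n c1 K m M j| <= \sum_(j < m.+1) #|stuck n c1 K m M j|.
  elim/big_ind2: _ => [|X1 b1 X2 b2 H1 H2|//]; first by rewrite cards0.
  by apply: leq_trans (leq_card_setU _ _) (leq_add H1 H2).
apply: leq_trans (leq_add (leqnn _) cB).
apply: leq_trans (_ : #|B1 :|: B2 :|: B3 :|: \bigcup_(j < m.+1) stuck n c1 K m M j| <= _);
  last first.
  do 3?(apply: leq_trans (leq_card_setU _ _) _; rewrite ?leq_add2r).
  by [].
apply/subset_leq_card/subsetP => s; rewrite [in X in X -> _]in_set => nh; rewrite 3!in_setU.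
apply: contraT; rewrite 3!negb_or => /andP[/andP[/andP[s1 s2] s3] /negP[]].
move: s1 s2 s3; rewrite 3!in_set -leqNgt !negbK => s1 /asboolP s2 /asboolP s3.
have [|j js] := not_target_stuck n0 s1 s2 s3.
  by apply: contra nh => /(target0 ham1) ?; apply/asboolP.
by apply/bigcupP; exists j.
Qed.

End FixedSize.
(** The parameters are [m = D = y] and [M = y ^ 12]. The factor [M * M = y ^ 24] beats [n], of order
    [y ^ 20], times the robustness bound of order [y ^ 2], so each of the [y.+1] stuck sets has
    probability of order [1 / y ^ 2]. *)
Lemma card_not_hamiltonian_asymp : exists C y0, forall n y, y0 <= y -> y ^ 20 <= n < y.+1 ^ 20 ->
  #|[set s : {ffun edge G -> 'S_n} | ~~ `[< hamiltonian (lift_graph s) >]]| * y <=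
    C * #|{: {ffun edge G -> 'S_n}}|.
Proof.
have [u _] := vertex_exists; have k0 : 0 < #|G| by apply/card_gt0P; exists u.
(* Degree 21 gives both [y.+1 ^ 21 <= 2 ^ y.+1], as [9 <= 16], and the hypothesis on [M] in
   [card_stuck]; [E] bounds the ratio of [y.+1 ^ 20] to [y ^ 20]. *)
have [y1 Hy1] := exp_beats_poly 21; pose E := 2 ^ 20.
pose C0 := #|G| ^ 4 * (3 * (2 * (32 * #|G|)) ^ #|G|).
exists (1 + 2 * (256 * #|G|) + 1 + 2 * (36 * (C0 * E))),
  (y1 + (512 * #|G| + 10 * #|G| * #|G| + 600)).
move=> n y yb /andP[yn ny].
have [yA K8 big] := size_bounds k0 (leq_trans (leq_addl _ _) yb).
have yy1 : y1 <= y := leq_trans (leq_addr _ _) yb.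
have y0 : 0 < y by apply: leq_trans yA; rewrite !muln_gt0.
have y2 : 2 <= y by apply: leq_trans yA; rewrite leq_pmulr // muln_gt0.
have n0 : 0 < n by apply: leq_trans yn; rewrite expn_gt0 y0.
pose O := #|{: {ffun edge G -> 'S_n}}|; pose K := y + y + #|G| + 2; pose M := y ^ 12.
have := @card_not_hamiltonian n K y M n0; set NH := #|_|.
set b1 := #|_|; set b2 := #|_|; set b3 := #|_|; set bs := \sum_(j < _) _ => Hsum.
have B1 : b1 * y <= O.
  have := @card_orbits G n c1 ham1 y.+1; rewrite -/b1 -/O => H.
  rewrite -(leq_pmul2l (ltn0Sn n)) mulnCA; apply: leq_trans H.
  rewrite leq_mul2l; apply/orP; right.
  have e8 : 0 < 8 ^ y.+1 by rewrite expn_gt0.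
  have H21 : y.+1 ^ 21 <= 2 ^ y.+1.
    rewrite -(leq_pmul2r e8) -expnMn; apply: ltnW; apply: leq_trans (Hy1 _ (leqW yy1)) _.
    by rewrite leq_exp2r.
  by apply: leq_trans H21; rewrite [y.+1 ^ 21]expnS mulnC leq_mul.
have B2 : b2 * y <= 2 * (256 * #|G|) * O.
  have := @card_not_expanding G n M y mindeg k0 yA; rewrite -/b2 -/O => H.
  rewrite -mulnA; apply: H; apply: leq_trans yn.
  rewrite /M -mulnA -expnD [y ^ 20](expnD y 2 18); apply: leq_mul; last exact: leqnn.
  by apply: (@leq_trans (2 ^ 2)); rewrite // leq_exp2r.
have B3 : b3 * y <= O.
  apply: leq_trans (card_disconnected ham1 ham2 disj n0); rewrite leq_mul2l; apply/orP; right.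
  by apply: leq_trans yn; rewrite -{1}[y]expn1 leq_pexp2l.
have B4 j : j < y.+1 -> #|stuck n c1 K y M j| * y ^ 2 <= 36 * (C0 * E) * O.
  rewrite ltnS => jy; have HK : y + y + #|G| + 2 <= K by [].
  pose q := K * (y - j) + (y + y + #|G|).
  have qK : q <= K * y.+1.
    by rewrite mulnS addnC leq_add // ?leq_mul2l ?leq_subr ?orbT // leq_addr.
  have hq : 32 * #|G| * (#|G| + 5) * q.+1 <= n.
    by apply: leq_trans (leq_trans big yn); rewrite leq_mul2l ltnS qK orbT.
  have [th1 th2] := threshold_bounds k0 hq.
  have D8 : 8 ^ y * M < 9 ^ y.
    apply: leq_ltn_trans (Hy1 y yy1); rewrite mulnC leq_mul2r; apply/orP; right.
    by rewrite leq_pexp2l.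
  have C2 : 2 <= 32 * #|G| by rewrite (leq_mul (_ : 2 <= 32) k0).
  have := card_stuck ham1 ham2 disj nonbip HK jy D8 n0 C2 th1 th2.
  rewrite -/O => H0.
  have H : #|stuck n c1 K y M j| * (M * M) <= C0 * (O * (2 * (2 * (K * y.+1) + 2) * n)).
    by rewrite /C0 -mulnA.
  have nE : n <= E * y ^ 20.
    apply: leq_trans (ltnW ny) _; rewrite -expnMn leq_exp2r //.
    by rewrite mul2n -addnn -addn1 leq_add2l.
  have cst : 2 * (2 * (K * y.+1) + 2) <= 36 * y ^ 2.
    have : 1 <= y ^ 2 by rewrite expn_gt0 y0.
    by move: (K * y.+1) (y ^ 2) K8; clear; lia.
  have y22 : 0 < y ^ 22 by rewrite expn_gt0 y0.
  rewrite -(leq_pmul2r y22) -mulnA -expnD; apply: leq_trans (_ : _ <=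
    #|stuck n c1 K y M j| * (M * M)) _.
    by rewrite /M -expnD.
  apply: leq_trans H _.
  apply: leq_trans (_ : C0 * (O * (36 * y ^ 2 * (E * y ^ 20))) <= _).
    by rewrite !leq_mul2l leq_mul ?orbT.
  by rewrite [y ^ 22](expnD y 2 20); move: (y ^ 2) (y ^ 20) (C0) (O) (E); clear; lia.
have B5 : bs * y <= 2 * (36 * (C0 * E)) * O.
  rewrite -(leq_pmul2r y0) -mulnA; apply: leq_trans (_ : _ <= y.+1 * (36 * (C0 * E) * O)) _.
    have -> : y.+1 * (36 * (C0 * E) * O) = \sum_(j < y.+1) 36 * (C0 * E) * O.
      by rewrite sum_nat_const card_ord.
    rewrite big_distrl /=.
    by apply: leq_sum => j _; rewrite -[y * y]/(y ^ 2); apply: B4.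
  have : y.+1 <= 2 * y by rewrite mul2n -addnn -addn1 leq_add2l.
  by move/(fun h => leq_mul h (leqnn (36 * (C0 * E) * O)))/leq_trans; apply; lia.
move: B2 B5; move: (2 * (256 * _)) (2 * (36 * _)) => a z B2 B5.
apply: leq_trans (leq_mul Hsum (leqnn y)) _; rewrite 6!mulnDl mul1n.
exact: leq_add (leq_add (leq_add B1 B2) B3) B5.
Qed.

End Assembly.

Import Order.TTheory GRing.Theory Num.Theory numFieldNormedType.Exports.

Theorem theorem1 (R : realType) (G : sgraph) (c1 c2 : seq G)
  (mindeg : forall u : G, 5 <= degree u)
  (ham1 : hamilton_cycle c1) (ham2 : hamilton_cycle c2)
  (disj : edge_disjoint c1 c2)
  (nonbip : ~ bipartite (relU (cycle_edge c1) (cycle_edge c2))) :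
  lift_aas R G hamiltonian.
Proof.
have [C [y0 HC]] := card_not_hamiltonian_asymp mindeg ham1 ham2 disj nonbip.
rewrite /lift_aas; apply/(@cvgrPdist_lt R R) => eps eps0.
(* [N] exceeds the inverse of [eps]; once [y] is at least [N * C.+1], the exceptional fraction, at
   most [C / y], is at most [1 / N]. *)
pose N := (Num.truncn (eps^-1)%R).+1.
have Neps : (N%:R^-1 < eps)%R.
  by rewrite -[ltRHS]invrK ltf_pV2 ?posrE ?invr_gt0 ?ltr0n // truncnS_gt.
exists ((y0 + N * C.+1) ^ 20) => // n /= n_large.
have [y yn] := root_exists n (isT : 0 < 20).
have yb : y0 + N * C.+1 <= y.
  by rewrite -ltnS -(ltn_exp2r _ _ (isT : 0 < 20)); case/andP: yn => _; apply: leq_ltn_trans.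
have {}HC := HC n y (leq_trans (leq_addr _ _) yb) yn.
set O := #|{: {ffun edge G -> 'S_n}}| in HC; set B := #|_| in HC.
have O0 : 0 < O by apply/card_gt0P; exists [ffun=> 1%g].
have BN : B * N <= O.
  rewrite -(leq_pmul2r (ltn0Sn C)) -mulnA; apply: leq_trans (leq_mul (leqnn B) _) _; last first.
    by apply: leq_trans HC _; rewrite mulnC leq_mul2l leqnSn orbT.
  exact: leq_trans (leq_addl _ _) yb.
have good : (#|[pred s : {ffun edge G -> 'S_n} | `[< hamiltonian (lift_graph s) >]]| + B = O)%N.
  apply: etrans (cardC [pred s : {ffun edge G -> 'S_n} | `[< hamiltonian (lift_graph s) >]]).
  by congr addn; apply: eq_card => s; rewrite !inE.
rewrite /lift_prob /unif_prob.
have OR : ((O%:R : R) != 0)%R by rewrite pnatr_eq0 -lt0n.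
have -> : (1 - #|[pred s : {ffun edge G ->
  'S_n} | `[< hamiltonian (lift_graph s) >]]|%:R / O%:R = B%:R / O%:R :> R)%R.
  by rewrite -[X in (X - _)%R](divff OR) -mulrBl -good natrD addrC addKr.
rewrite ger0_norm ?divr_ge0 // (le_lt_trans _ Neps) // ler_pdivrMr ?ltr0n //.
by rewrite ler_pdivlMl ?ltr0n // -natrM ler_nat mulnC.
Qed.
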